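(* Let $(E,\mathcal E,\mu)$ be a probability space, $\Omega=\prod_{k\ge 1}E$, $\mathcal F_\infty=\bigotimes_{k\ge 1}\mathcal E$ and $\mathbb{P}=\bigotimes_{k\ge 1}\mu$. For $j\in\mathbb{N}$ let $\mathrm{pr}_j:\Omega\to E$, $(x_1,x_2,\dots)\mapsto x_j$, and let $\theta:\Omega\to\Omega$, $(x_1,x_2,\dots)\mapsto(x_2,x_3,\dots)$, be the shift operator (which satisfies $\mathbb{P}\circ\theta^{-1}=\mathbb{P}$). Let $f\in L^2(\Omega,\mathcal F_\infty,\mathbb{P})$ be real-valued with $\int f\,d\mathbb{P}=0$. For $r\ge 1$ put $$f_r=\mathbb{E}[f\mid\mathcal F_r],\qquad \phi_r=f-f_r,\qquad \mathcal F_r=\sigma(\mathrm{pr}_1,\dots,\mathrm{pr}_r).$$ Suppose $\sum_{r\ge 1}\|\phi_r\|_2<\infty$. Then the limit $$\sigma^2=\lim_{n\to\infty}\frac1n\,\mathbb{E}\big[(f+f\circ\theta+\cdots+f\circ\theta^{n-1})^2\big]$$ exists and, provided $\sigma^2$ is different from zero, for every $t\in\mathbb{R}$, as $n\to\infty$, $$\mathbb{P}\Big[\frac{1}{\sqrt n}\sum_{k=0}^{n-1}f\circ\theta^k\le t\Big]\ \longrightarrow\ \frac{1}{\sigma\sqrt{2\pi}}\int_{-\infty}^t e^{-\frac{u^2}{2\sigma^2}}\,du .$$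
   Context: $\|\cdot\|_2$ is the norm of $L^2(\Omega,\mathcal F_\infty,\mathbb{P})$, and $\mathbb{E}$ is expectation with respect to $\mathbb{P}$. *)

(* Defs.v *)
From HB Require Import structures.
From mathcomp Require Import all_boot all_order all_algebra.
From mathcomp Require Import all_classical all_reals all_analysis.

Set Implicit Arguments.
Unset Strict Implicit.
Unset Printing Implicit Defensive.

Import Order.TTheory GRing.Theory Num.Theory.
Import numFieldNormedType.Exports.

Local Open Scope classical_set_scope.
Local Open Scope ring_scope.

Section sequence_space.
Context {d : measure_display} {E : measurableType d}.

(* Coordinates are indexed from 0: [seq_coord j] is the projection onto the
   (j+1)-st component of (x_1, x_2, ...). *)
Definition seq_coord (j : nat) (x : nat -> E) : E := x j.

Definition coord_preimages : set (set (nat -> E)) :=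
  \bigcup_(j in [set: nat]) preimage_set_system setT (seq_coord j) measurable.

(* The sequence space with the product sigma-algebra, i.e. the sigma-algebra
   generated by all the coordinates. *)
Definition seq_space := g_sigma_algebraType coord_preimages.

(* sigma(pr_1, ..., pr_r) *)
Definition coord_sigma (r : nat) : set (set seq_space) :=
  g_sigma_preimage (fun i : 'I_r => seq_coord i).

Definition seq_shift (x : seq_space) : seq_space := fun j => x j.+1.

(* The product measure is the unique probability measure on the product
   sigma-algebra whose value on measurable cylinders is given by the product
   formula. *)
Definition is_product_measure {R : realType} (mu : probability E R)
    (P : probability seq_space R) : Prop :=
  forall (n : nat) (A : 'I_n -> set E), (forall i, measurable (A i)) ->
    P (\bigcap_(i in [set: 'I_n]) (seq_coord i @^-1` A i)) =
    (\prod_(i < n) mu (A i))%E.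

End sequence_space.

Arguments seq_space {d} E.

(* [g] is a version of the conditional expectation E[f | G]; it is only meant
   for G a sub-sigma-algebra of the measurable sets and f integrable. *)
Definition is_cond_exp {d : measure_display} {T : measurableType d}
    {R : realType} (P : probability T R) (G : set (set T)) (f g : T -> R)
    : Prop :=
  [/\ preimage_set_system setT g measurable `<=` G,
      P.-integrable setT (EFin \o g) &
      forall A, G A ->
        (\int[P]_(x in A) (g x)%:E = \int[P]_(x in A) (f x)%:E)%E].

Definition birkhoff_sum {T : Type} {R : realType} (f : T -> R) (theta : T -> T)
    (n : nat) (x : T) : R :=
  \sum_(k < n) f (iter k theta x).

(* Main.v *)
From HB Require Import structures.
Require Import Defs.
From mathcomp Require Import all_boot all_order all_algebra.
From mathcomp Require Import all_classical all_reals all_analysis.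
From mathcomp Require Import measurable_realfun zify ring lra.

(** Write [theta] for the shift, [S_n f] for the Birkhoff sum of length [n],
    [N] for the norm of L^2(P), [phi_r = f - f_r] and [C] for the sum of the
    [N phi_r], [r >= 1].

    Approximation by independent blocks.  In a window of length [p], the term
    [f o theta^k] sees only the coordinates [k + 1, ..., p], that is, [p - k]
    of them.  Replacing it by [f_(p-k) o theta^k] turns [S_p f] into
    [Y = sum_(k < p) f_(p-k) o theta^k] ([block]), a centred function of the
    first [p] coordinates, and the error [W = sum_(k < p) phi_(p-k) o theta^k]
    ([defect]) has norm at most [C], whatever [p] is.  The errors of different
    windows are almost uncorrelated: [W] differs from a function of the first
    [p j] coordinates by [sum_(k < p) phi_(pj-k) o theta^k], and such a function
    is uncorrelated with [W o theta^(pj)], so that the correlation of [W] and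
    [W o theta^(pj)] is at most [C] times the [j]-th block of length [p] of the
    series [sum N phi_r] ([ip_defect_shift]).  These bounds add up to [C^2] over
    [j >= 1], hence the sum of [W o theta^(pj)] over [j < m] has squared norm at
    most [3 m C^2] ([sqr_nrm_defect_sum]).  Therefore [S_n f / sqrt n] is within
    [sqrt 3 C / sqrt p + o(1)] of the normalized sum of the variables
    [Y o theta^(pj)], which are independent and identically distributed
    ([normalized_sum_block_dist]).

    The variance.  The norm of that normalized sum is [N Y / sqrt p], which does
    not depend on [n].  So the sequence [N (S_n f) / sqrt n] stays eventually
    within [2 sqrt 3 C / sqrt p] of a constant, for each [p]: it is a Cauchy
    sequence ([nrm_normalized_sum_cvg]), and [sigma] is its limit.

    The central limit theorem.  For a test function [h] with a second order
    Taylor expansion, Lindeberg's replacement of the blocks by Gaussian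
    variables, one at a time, compares the expectation of [h] at the block sum
    with its Gaussian integral ([lindeberg]).  The Gaussian variables are given
    the limit variance [sigma^2] at once instead of the variance of the blocks:
    the price is a term proportional to [|N Y ^2 / p - sigma^2|], which vanishes
    as [p] grows.  Independence enters through [splice], which makes a point of
    the sequence space out of the first [p] coordinates of one point and of
    another point; it maps [P x P] to [P], and reduces every statement on
    independence to Fubini's theorem.  Finally, the distribution functions are
    squeezed between expectations of cubic spline steps
    ([cdf_cvg_of_smooth_tests]). *)

Set Implicit Arguments.
Unset Strict Implicit.
Unset Printing Implicit Defensive.
Import Order.TTheory GRing.Theory Num.Theory.
Import numFieldNormedType.Exports.
Local Open Scope classical_set_scope.
Local Open Scope ring_scope.

(** * Test functions *)

Section test_functions.
Context {R : realType}.
Implicit Types (h : R -> R) (K x y t d : R).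

(** Third order at the origin, which makes the sum of the Taylor remainders over
    the blocks negligible, but only second order at infinity, which keeps the
    remainder integrable for square integrable variables. *)
Definition taylor_weight y : R := y ^+ 2 * Num.min `|y| 1.

Lemma taylor_weight_ge0 y : 0 <= taylor_weight y.
Proof. by rewrite mulr_ge0 ?sqr_ge0// le_min normr_ge0 ler01. Qed.

Definition lipschitz_test h K : Prop :=
  (forall x, 0 <= h x <= 1) /\ (forall x y, `|h x - h y| <= K * `|x - y|).

(** A second order expansion with a uniform remainder, in which [b] stands for half
    the second derivative.  It is phrased without derivatives so that it can be
    checked algebraically and integrated at once. *)
Definition smooth_test h K : Prop := lipschitz_test h K /\
  exists a b : R -> R, (forall x, `|b x| <= K) /\
    forall x y, `|h (x + y) - h x - a x * y - b x * y ^+ 2| <= K * taylor_weight y.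

Definition pos_cube x : R := Num.max x 0 ^+ 3.
Definition pos_square x : R := Num.max x 0 ^+ 2.
Definition pos_lin x : R := Num.max x 0.

(** The cube of the positive part is twice continuously differentiable; its
    expansion is checked according to the signs of [x] and [x + y], and all the
    smoothness used later comes from this inequality. *)
Lemma pos_cube_taylor x y :
  `|pos_cube (x + y) - pos_cube x - 3 * pos_square x * y - 3 * pos_lin x * y ^+ 2|
  <= `|y| ^+ 3.
Proof.
rewrite /pos_cube /pos_square /pos_lin.
have [x0|x0] := leP x 0; have [xy0|xy0] := leP (x + y) 0.
- by rewrite !expr0n/= !(mulr0, mul0r, subr0, normr0) exprn_ge0.
- rewrite !expr0n/= !(mulr0, mul0r, subr0) normrX gtr0_norm//.
  rewrite lerXn2r ?nnegrE ?normr_ge0 ?(ltW xy0)//.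
  by rewrite (le_trans _ (ler_norm y))//; lra.
- have -> : 0 ^+ 3 - x ^+ 3 - 3 * x ^+ 2 * y - 3 * x * y ^+ 2 =
            (- (x + y)) ^+ 3 - (- y) ^+ 3 :> R by ring.
  have y0 : y <= 0 by lra.
  rewrite distrC (ler0_norm y0) ger0_norm ?subr_ge0; last first.
    by rewrite lerXn2r ?nnegrE//; lra.
  by rewrite lerBlDr lerDl exprn_ge0//; lra.
- have -> : (x + y) ^+ 3 - x ^+ 3 - 3 * x ^+ 2 * y - 3 * x * y ^+ 2 = y ^+ 3 :> R
    by ring.
  by rewrite normrX.
Qed.

Definition third_diff (g : R -> R) x : R :=
  g x - 3 * g (x - 1) + 3 * g (x - 2) - g (x - 3).

(** The integral of the quadratic B-spline with knots 0, 1, 2, 3: since the third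
    difference of [x^3 / 6] is 1, it climbs from 0 to 1 on the interval [0, 3]. *)
Definition spline x : R := third_diff pos_cube x / 6.

Lemma spline_le0 x : x <= 0 -> spline x = 0.
Proof.
move=> x0; rewrite /spline /third_diff /pos_cube !max_r; lra.
Qed.

Lemma spline_ge3 x : 3 <= x -> spline x = 1.
Proof.
move=> x3; rewrite /spline /third_diff /pos_cube !max_l; lra.
Qed.

Lemma spline01 x : 0 <= spline x <= 1.
Proof.
have [x0|x0] := leP x 0; first by rewrite spline_le0// lexx ler01.
have [x3|x3] := leP 3 x; first by rewrite spline_ge3// lexx ler01.
have cube01 w : 0 <= w <= 1 -> 0 <= w ^+ 3 <= w ^+ 2 /\ w ^+ 2 <= w :> R.
  move=> /andP[w0 w1]; split; last by rewrite expr2 ler_piMl.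
  by rewrite exprn_ge0//= exprS ler_piMl// sqr_ge0.
rewrite /spline /third_diff /pos_cube.
rewrite (max_l (ltW x0)) (@max_r _ _ (x - 3)); last lra.
have [x1|x1] := leP (x - 1) 0; have [x2|x2] := leP (x - 2) 0.
- have [|/andP[? ?] ?] := cube01 x; first by apply/andP; split; lra.
  by apply/andP; split; lra.
- lra.
- have [|/andP[? ?] ?] := cube01 (x - 1); first by apply/andP; split; lra.
  have [|/andP[? ?] ?] := cube01 (2 - x); first by apply/andP; split; lra.
  by apply/andP; split; lra.
- have [|/andP[? ?] ?] := cube01 (3 - x); first by apply/andP; split; lra.
  by apply/andP; split; lra.
Qed.

Lemma spline_slope x : `|third_diff pos_square x / 2| <= 1.
Proof.
rewrite /third_diff /pos_square ler_norml.
case: (leP x 0) => ?; case: (leP (x - 1) 0) => ?;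
case: (leP (x - 2) 0) => ?; case: (leP (x - 3) 0) => ?;
  rewrite ?expr0n/=; try lra; by apply/andP; split; nra.
Qed.

Lemma spline_curvature x : `|third_diff pos_lin x / 2| <= 1.
Proof.
rewrite /third_diff /pos_lin ler_norml.
case: (leP x 0) => ?; case: (leP (x - 1) 0) => ?;
case: (leP (x - 2) 0) => ?; case: (leP (x - 3) 0) => ?;
  rewrite ?expr0n/=; by apply/andP; split; lra.
Qed.

Lemma spline_taylor3 x y :
  `|spline (x + y) - spline x - third_diff pos_square x / 2 * y
    - third_diff pos_lin x / 2 * y ^+ 2| <= 2 * `|y| ^+ 3.
Proof.
pose e z := pos_cube (z + y) - pos_cube z - 3 * pos_square z * y
            - 3 * pos_lin z * y ^+ 2.
have eE z : `|e z| <= `|y| ^+ 3 by exact: pos_cube_taylor.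
have -> : spline (x + y) - spline x - third_diff pos_square x / 2 * y
    - third_diff pos_lin x / 2 * y ^+ 2 = third_diff e x / 6.
  rewrite /spline /third_diff /e.
  rewrite (_ : x - 1 + y = x + y - 1); last by ring.
  rewrite (_ : x - 2 + y = x + y - 2); last by ring.
  rewrite (_ : x - 3 + y = x + y - 3); last by ring.
  by field.
have := eE x; have := eE (x - 1); have := eE (x - 2); have := eE (x - 3).
rewrite !ler_norml /third_diff => /andP[? ?] /andP[? ?] /andP[? ?] /andP[? ?].
by apply/andP; split; lra.
Qed.

(** For increments [|y| <= 1] the third order bound is enough; for larger ones,
    each term of the expansion is at most [y^2], as the spline, its slope and its
    curvature are bounded. *)
Lemma spline_smooth : smooth_test spline 4.
Proof.
split; first split.
- exact: spline01.
- move=> x y; have := spline_taylor3 y (x - y).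
  rewrite subrKC; set z := x - y => tz.
  have [z1|z1] := leP `|z| 1; last first.
    rewrite (@le_trans _ _ 1)//; last by lra.
    have := spline01 x; have := spline01 y; rewrite ler_norml.
    by move=> /andP[? ?] /andP[? ?]; apply/andP; split; lra.
  have hz3 : `|z| ^+ 3 <= `|z|.
    rewrite -[leRHS]mulr1 exprS ler_wpM2l// expr_le1//.
  have hz2 : `|z ^+ 2| <= `|z|.
    by rewrite normrX -[leRHS]mulr1 expr2 ler_wpM2l.
  have sl := spline_slope y; have cu := spline_curvature y.
  set u := third_diff pos_square y / 2 in tz sl.
  set v := third_diff pos_lin y / 2 in tz cu.
  have -> : spline x - spline y = (spline x - spline y - u * z - v * z ^+ 2)
             + u * z + v * z ^+ 2 by ring.
  apply: le_trans (ler_normD _ _) _.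
  have : `|v * z ^+ 2| <= `|z|.
    by rewrite normrM -[leRHS]mul1r ler_pM.
  have : `|u * z| <= `|z| by rewrite normrM ler_piMl.
  have := ler_normD (spline x - spline y - u * z - v * z ^+ 2) (u * z).
  lra.
- exists (fun x => third_diff pos_square x / 2),
         (fun x => third_diff pos_lin x / 2); split.
    by move=> x; apply: le_trans (spline_curvature x) _; lra.
  move=> x y; rewrite /taylor_weight.
  have [y1|y1] := leP `|y| 1.
    have := spline_taylor3 x y; rewrite (exprSr `|y|) (real_normK (num_real y)).
    move=> /le_trans; apply; rewrite ler_wpM2r//; last by lra.
    by rewrite mulr_ge0 ?sqr_ge0.
  have y2 : `|y| <= y ^+ 2.
    by rewrite -(real_normK (num_real y)) expr2 ler_peMl// ltW.
  have y3 : 1 <= y ^+ 2 by rewrite (le_trans (ltW y1)).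
  have sl := spline_slope x; have cu := spline_curvature x.
  set u := third_diff pos_square x / 2 in sl *.
  set v := third_diff pos_lin x / 2 in cu *.
  have hv : `|v * y ^+ 2| <= y ^+ 2.
    by rewrite normrM (ger0_norm (sqr_ge0 y)) ler_piMl ?sqr_ge0.
  have hu : `|u * y| <= `|y| by rewrite normrM ler_piMl.
  have hs : `|spline (x + y) - spline x| <= 1.
    have := spline01 x; have := spline01 (x + y); rewrite ler_norml.
    by move=> /andP[? ?] /andP[? ?]; apply/andP; split; lra.
  have := ler_normB (spline (x + y) - spline x) (u * y).
  have := ler_normB (spline (x + y) - spline x - u * y) (v * y ^+ 2).
  lra.
Qed.

Lemma lipschitz_test_ge0 h K : lipschitz_test h K -> 0 <= K.
Proof.
case=> _ /(_ 1 0); rewrite subr0 normr1 mulr1; exact: le_trans.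
Qed.

Lemma taylor_weight_scale (c y : R) :
  taylor_weight (c * y) <= c ^+ 2 * (1 + `|c|) * taylor_weight y.
Proof.
rewrite /taylor_weight exprMn normrM.
set m := Num.min `|y| 1.
suff mc : Num.min (`|c| * `|y|) 1 <= (1 + `|c|) * m.
  have := ler_wpM2l (mulr_ge0 (sqr_ge0 c) (sqr_ge0 y)) mc.
  suff -> : c ^+ 2 * (1 + `|c|) * (y ^+ 2 * m) =
    c ^+ 2 * y ^+ 2 * ((1 + `|c|) * m) by [].
  by ring.
have c0 := normr_ge0 c; have y0 := normr_ge0 y.
by rewrite /m; case: (leP `|y| 1) => h; rewrite ge_min; apply/orP; [left|right]; nra.
Qed.

Lemma smooth_test_affine h K (c e : R) : smooth_test h K ->
  exists K', smooth_test (fun x => h (c * x + e)) K'.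
Proof.
case=> lh [a [b [bK habE]]]; have K0 := lipschitz_test_ge0 lh; case: lh => h01 hL.
have k1 : 0 <= K * `|c| by rewrite mulr_ge0.
have k2 : 0 <= K * c ^+ 2 by rewrite mulr_ge0 ?sqr_ge0.
have k3 : 0 <= K * c ^+ 2 * `|c| by rewrite mulr_ge0.
exists (K * (c ^+ 2 * (1 + `|c|)) + K * `|c|); split; first split.
- by move=> x; exact: h01.
- move=> x y; apply: le_trans (hL _ _) _.
  rewrite (_ : c * x + e - (c * y + e) = c * (x - y)); last by ring.
  rewrite normrM (mulrA K `|c|) ler_wpM2r//.
  by lra.
- exists (fun x => a (c * x + e) * c), (fun x => b (c * x + e) * c ^+ 2); split.
    move=> x; rewrite normrM (ger0_norm (sqr_ge0 c)).
    rewrite (le_trans (ler_wpM2r (sqr_ge0 c) (bK _)))//; lra.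
  move=> x y; have := habE (c * x + e) (c * y).
  rewrite (_ : c * x + e + c * y = c * (x + y) + e); last by ring.
  rewrite (_ : a (c * x + e) * (c * y) = a (c * x + e) * c * y); last by ring.
  rewrite (_ : b (c * x + e) * (c * y) ^+ 2 = b (c * x + e) * c ^+ 2 * y ^+ 2);
    last by ring.
  move=> /le_trans; apply.
  have := ler_wpM2l K0 (taylor_weight_scale c y).
  have := mulr_ge0 k1 (taylor_weight_ge0 y).
  lra.
Qed.

Lemma lipschitz_test_continuous h K : lipschitz_test h K -> continuous h.
Proof.
move=> lh; have K0 := lipschitz_test_ge0 lh; case: lh => _ hL x.
apply/cvgrPdist_le => e e0; near=> y.
rewrite (le_trans (hL _ _))//.
rewrite (@le_trans _ _ ((K + 1) * `|x - y|))//; first by rewrite ler_wpM2r// lerDl.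
rewrite -ler_pdivlMl; last by lra.
near: y; have /cvgrPdist_le := @cvg_id _ (nbhs x).
by apply; rewrite mulr_gt0// invr_gt0; lra.
Unshelve. all: by end_near. Qed.

Lemma smooth_step t d : 0 < d ->
  exists h K, [/\ smooth_test h K, forall x, x <= t -> h x = 1 &
                  forall x, t + d <= x -> h x = 0].
Proof.
move=> d0; have [K sK] := smooth_test_affine (- (3 / d)) (3 + 3 / d * t) spline_smooth.
eexists; exists K; split; first exact: sK.
- move=> x xt /=; rewrite spline_ge3//.
  have : 0 <= 3 / d * (t - x) by rewrite mulr_ge0 ?subr_ge0// divr_ge0 ?ltW//; lra.
  lra.
- move=> x xt /=; rewrite spline_le0//.
  have : 3 / d * d <= 3 / d * (x - t) by rewrite ler_wpM2l ?divr_ge0 ?(ltW d0)//; lra.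
  rewrite divfK ?gt_eqF//; lra.
Qed.

End test_functions.

(** * Gaussian integrals *)

Section gaussian.
Context {R : realType}.
Local Notation leb := (@lebesgue_measure R).

(** The density of the normal law is a Radon-Nikodym derivative with respect to
    Lebesgue measure, and such derivatives are unique almost everywhere. *)
Lemma ge0_integral_normal_prob (m s : R) (f : R -> \bar R) :
  (forall x, 0 <= f x)%E -> measurable_fun setT f ->
  (\int[normal_prob m s]_x f x = \int[leb]_x (f x * (normal_pdf m s x)%:E))%E.
Proof.
move=> f0 mf.
have dom := normal_prob_dominates m s.
rewrite -(Radon_Nikodym_SigmaFinite.change_of_variables dom f0 measurableT mf).
have mRN : measurable_fun setT (Radon_Nikodym_SigmaFinite.f (normal_prob m s) leb).
  apply: (measurable_int leb); exact: Radon_Nikodym_SigmaFinite.f_integrable.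
apply: ae_eq_integral => //.
- exact: emeasurable_funM.
- by apply: emeasurable_funM => //; apply/measurable_EFinP;
    exact: measurable_normal_pdf.
- apply: ae_eqe_mul2l; apply: integral_ae_eq => //.
  + exact: Radon_Nikodym_SigmaFinite.f_integrable.
  + by apply/measurable_EFinP; exact: measurable_normal_pdf.
  + move=> E _ mE; rewrite -Radon_Nikodym_SigmaFinite.f_integral//.
Qed.

Definition stdnormal : probability _ R := normal_prob (0 : R) (1 : R).

Lemma normal_pdf_affine (a s z : R) : 0 < s ->
  s * normal_pdf a s (a + s * z) = normal_pdf 0 1 z.
Proof.
move=> s0; rewrite !normal_pdfE ?oner_eq0 ?gt_eqF//.
rewrite /normal_peak /normal_fun expr1n mul1r subr0 mulrA; congr (_ * expR _).
  rewrite -[s ^+ 2 * pi *+ 2]mulr_natr -mulrA mulr_natr sqrtrM ?sqr_ge0//.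
  by rewrite sqrtr_sqr gtr0_norm// invfM mulrA divff ?mul1r// gt_eqF.
by field; rewrite gt_eqF.
Qed.

Lemma integral_stdnormal_affine (a s : R) (h : R -> R) : 0 < s ->
  continuous h -> (forall x, 0 <= h x) ->
  (\int[stdnormal]_z (h (a + s * z))%:E =
   \int[leb]_y (h y * normal_pdf a s y)%:E)%E.
Proof.
move=> s0 ch h0.
have s_neq0 : s != 0 by rewrite gt_eqF.
pose F (z : R^o) : R^o := a + s * z.
have F' (z : R^o) : derivable F z 1 by [].
have F'E : F^`()%classic = cst s.
  apply/funext => z; rewrite /F derive1E deriveD// derive_cst add0r.
  by rewrite deriveM// derive_id derive_cst scaler0 addr0 scaler1.
rewrite (@ge0_integral_normal_prob 0 1 (fun z => (h (a + s * z))%:E)); last 2 first.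
- by move=> z; rewrite lee_fin.
- apply/measurable_EFinP; apply: (measurableT_comp (continuous_measurable_fun ch)).
  by apply: measurable_funD => //; exact: measurable_funM.
rewrite (@increasing_ge0_integration_by_substitutionT _ F
  (fun y => h y * normal_pdf a s y)); last first.
- by move=> y; rewrite mulr_ge0// normal_pdf_ge0.
- move=> y; apply: (@continuousM _ _ h (normal_pdf a s)); first exact: ch.
  exact: continuous_normal_pdf.
- apply: (@cvg_comp _ _ _ (fun z : R => s * z) (fun u : R => a + u)).
    exact: gt0_cvgMry cvg_id.
  exact: cvg_addrl.
- apply: (@cvg_comp _ _ _ (fun z : R => s * z) (fun u : R => a + u)).
    exact: gt0_cvgMrNy cvg_id.
  exact: cvg_addrl_Ny.
- exact: F'.
- by rewrite F'E; exact: is_cvg_cst.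
- by rewrite F'E; exact: is_cvg_cst.
- by rewrite F'E => z; exact: cvg_cst.
- by move=> x y xy; rewrite /F ltrD2l ltr_pM2l.
apply: eq_integral => z _; rewrite F'E !fctE/= -EFinM; congr EFin.
by rewrite -(normal_pdf_affine a z s0) /F mulrCA mulrC.
Qed.

(** Completing the square in [z]: the joint density of the pair is the density
    of the sum times the conditional density of [z] given the sum. *)
Lemma normal_pdf_convolution (x s t y z : R) : 0 < s -> 0 < t ->
  let r := Num.sqrt (s ^+ 2 + t ^+ 2) in
  normal_pdf 0 1 z * normal_pdf (x + s * z) t y =
  normal_pdf x r y * normal_pdf (s * (y - x) / r ^+ 2) (t / r) z.
Proof.
move=> s0 t0 r.
have r20 : 0 < s ^+ 2 + t ^+ 2 by rewrite addr_gt0// exprn_gt0.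
have r0 : 0 < r by rewrite sqrtr_gt0.
have r2E : r ^+ 2 = s ^+ 2 + t ^+ 2 by rewrite sqr_sqrtr// ltW.
have tr0 : 0 < t / r by rewrite divr_gt0.
rewrite !normal_pdfE ?oner_eq0 ?gt_eqF//.
rewrite /normal_peak /normal_fun.
have pi0 := pi_gt0 R.
have peakE (u : R) : 0 < u -> Num.sqrt (u ^+ 2 * pi *+ 2) = u * Num.sqrt (pi *+ 2).
  move=> u0; rewrite -mulrnAr sqrtrM ?sqr_ge0// sqrtr_sqr gtr0_norm//.
rewrite !peakE// mulrACA [RHS]mulrACA; congr (_ * _).
  field; have c0 : 0 < Num.sqrt (pi *+ 2) :> R by rewrite sqrtr_gt0 pmulrn_lgt0.
  by rewrite !(@gt_eqF _ R _ 0).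
rewrite -!expRD; congr expR.
rewrite expr_div_n r2E; field.
by rewrite !gt_eqF.
Qed.

(** Independent Gaussian variables have a Gaussian sum.  After the integrals are
    exchanged, the inner variable only occurs in the conditional density of
    [normal_pdf_convolution], of total mass 1. *)
Lemma stdnormal_convolution (x s t : R) (h : R -> R) : 0 < s -> 0 < t ->
  continuous h -> (forall y, 0 <= h y) ->
  (\int[stdnormal]_z \int[stdnormal]_w (h (x + s * z + t * w))%:E =
   \int[stdnormal]_w (h (x + Num.sqrt (s ^+ 2 + t ^+ 2) * w))%:E)%E.
Proof.
move=> s0 t0 ch h0; set r := Num.sqrt _.
have r0 : 0 < r by rewrite sqrtr_gt0 addr_gt0// exprn_gt0.
have mh : measurable_fun setT h by exact: continuous_measurable_fun.
under eq_integral do rewrite integral_stdnormal_affine//.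
rewrite integral_stdnormal_affine//.
have mpdf : measurable_fun [set: R * R] (fun u => normal_pdf (x + s * u.1) t u.2).
  rewrite (_ : (fun _ => _) = (fun u : R * R => normal_pdf 0 t (u.2 - (x + s * u.1)))).
    apply: measurableT_comp; first exact: measurable_normal_pdf.
    apply: measurable_funB; first exact: measurable_snd.
    apply: measurable_funD => //; apply: measurable_funM => //; exact: measurable_fst.
  apply/funext => u; rewrite !normal_pdfE ?gt_eqF//.
  by rewrite /normal_fun subr0.
have mF : measurable_fun [set: R * R]
    (fun u => (h u.2 * normal_pdf (x + s * u.1) t u.2)%:E).
  apply/measurable_EFinP/measurable_funM => //.
  by apply: measurableT_comp => //; exact: measurable_snd.
have mG : measurable_fun [set: R * R]
    (fun u => (h u.2 * (normal_pdf 0 1 u.1 * normal_pdf (x + s * u.1) t u.2))%:E).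
  apply/measurable_EFinP/measurable_funM.
    by apply: measurableT_comp => //; exact: measurable_snd.
  apply: measurable_funM => //.
  by apply: measurableT_comp; [exact: measurable_normal_pdf|exact: measurable_fst].
rewrite ge0_integral_normal_prob; last 2 first.
- by move=> z; apply: integral_ge0 => y _; rewrite lee_fin mulr_ge0// normal_pdf_ge0.
- apply: (@measurable_fun_fubini_tonelli_F _ _ _ _ _ leb _ mF).
  by move=> u; rewrite lee_fin mulr_ge0// normal_pdf_ge0.
transitivity (\int[leb]_z \int[leb]_y
    (h y * (normal_pdf 0 1 z * normal_pdf (x + s * z) t y))%:E)%E.
  apply: eq_integral => z _; rewrite muleC -ge0_integralZl//.
  - by apply: eq_integral => y _; rewrite -EFinM; congr EFin; rewrite mulrCA.
  - apply/measurable_EFinP/measurable_funM => //; exact: measurable_normal_pdf.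
  - by move=> y _; rewrite lee_fin mulr_ge0// normal_pdf_ge0.
  - by rewrite lee_fin normal_pdf_ge0.
rewrite (@fubini_tonelli _ _ _ _ _ leb leb _ mG); last first.
  by move=> u; rewrite lee_fin !mulr_ge0// normal_pdf_ge0.
apply: eq_integral => y _ /=.
under eq_integral do rewrite normal_pdf_convolution// mulrA EFinM.
rewrite ge0_integralZl//; last 3 first.
- by apply/measurable_EFinP; exact: measurable_normal_pdf.
- by move=> z _; rewrite lee_fin normal_pdf_ge0.
- by rewrite lee_fin mulr_ge0// normal_pdf_ge0.
by rewrite integral_normal_pdf mule1.
Qed.

End gaussian.

(** * Moments of the standard Gaussian law *)

Section gaussian_moments.
Context {R : realType}.
Local Notation leb := (@lebesgue_measure R).
Local Notation pdf := (normal_pdf (0 : R) 1).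

Let pdfE z : pdf z = normal_peak 1 * expR (- (z ^+ 2 / 2)).
Proof.
rewrite normal_pdfE ?oner_eq0// /normal_fun subr0 expr1n mulNr.
by rewrite -[1 *+ 2]/(2%:R).
Qed.

Let pdf_ge0 z : 0 <= pdf z. Proof. exact: normal_pdf_ge0. Qed.

Let pdf_cont : continuous pdf.
Proof. by apply: continuous_normal_pdf; rewrite oner_eq0. Qed.

Let G (z : R) : R := - (z * pdf z).

Let is_derive_G (z : R) : is_derive z (1 : R) G ((z ^+ 2 - 1) * pdf z).
Proof.
rewrite /G (_ : (fun z => _) =
  (fun z : R => - (z * (normal_peak 1 * expR (- (z ^+ 2 / 2)))))); last first.
  by apply/funext => y; rewrite pdfE.
have d1 : is_derive z (1 : R) (fun z : R => - (z ^+ 2 / 2)) (- z).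
  by apply: is_derive_eq; rewrite /GRing.scale/=; field.
have := is_derive1_comp (is_derive_expR _) d1.
move=> d2.
by apply: is_derive_eq; rewrite /GRing.scale/= pdfE; ring.
Qed.

Let G_cvg : G z @[z --> +oo] --> (0 : R).
Proof.
apply/cvgrPdist_le => e e0; near=> z.
have z0 : 0 < z by near: z; exact: nbhs_pinfty_gt.
have c0 := normal_peak_ge0 (1 : R).
rewrite sub0r /G opprK ger0_norm ?mulr_ge0 ?(ltW z0)// pdfE expRN.
rewrite mulrA ler_pdivrMr ?expR_gt0//.
have : normal_peak 1 * 2 / e <= z by near: z; apply: nbhs_pinfty_ge; rewrite num_real.
rewrite ler_pdivrMr// => ze.
have := ler_wpM2l (ltW e0) (expR_ge1Dx (z ^+ 2 / 2)).
apply: le_trans; rewrite mulrDr mulr1.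
have := ler_wpM2l (ltW z0) ze; lra.
Unshelve. all: by end_near. Qed.

Let G_cont : continuous G.
Proof.
by move=> z; apply/differentiable_continuous/derivable1_diffP; case: (is_derive_G z).
Qed.

Let G'E (z : R) : G^`()%classic z = (z ^+ 2 - 1) * pdf z.
Proof. by rewrite derive1E; case: (is_derive_G z). Qed.

Let poly_pdf_cont (p : R -> R) : continuous p -> continuous (fun z => p z * pdf z).
Proof. by move=> cp z; apply: continuousM; [exact: cp|exact: pdf_cont]. Qed.

Let sqr_cont : continuous (fun z : R => z ^+ 2).
Proof. exact: sqr_continuous. Qed.

Let sqrB1_cont : continuous (fun z : R => z ^+ 2 - 1).
Proof.
by move=> z; apply: (@cvgB _ R^o); [exact: sqr_cont|exact: cvg_cst].
Qed.

Let m_pdf (p : R -> R) : continuous p -> forall D : set R,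
  measurable_fun D (fun z => (p z * pdf z)%:E).
Proof.
move=> cp D; apply/measurable_funTS/measurable_EFinP.
by apply: continuous_measurable_fun; exact: poly_pdf_cont.
Qed.

Let mpdf (D : set R) : measurable_fun D (EFin \o pdf).
Proof. by apply/measurable_funTS/measurable_EFinP; exact: measurable_normal_pdf. Qed.

(** The next two identities integrate the derivative [(z^2 - 1) pdf z] of
    [- z pdf z].  It changes sign at 1, so [0, 1] and [1, +oo[ are treated
    separately, where every integrand is nonnegative. *)
Let second_moment_tail :
  (\int[leb]_(z in `[1%R, +oo[) (z ^+ 2 * pdf z)%:E =
   (pdf 1)%:E + \int[leb]_(z in `[1%R, +oo[) (pdf z)%:E)%E.
Proof.
have -> : ((pdf 1)%:E = \int[leb]_(z in `[1%R, +oo[) ((z ^+ 2 - 1) * pdf z)%:E)%E.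
  rewrite (@ge0_continuous_FTC2y _ _ G 1 0).
  - by rewrite /G mul1r -EFinN opprK add0e.
  - by move=> z z1; rewrite mulr_ge0// subr_ge0 exprn_ege1.
  - by apply: continuous_subspaceT; exact: poly_pdf_cont.
  - exact: G_cvg.
  - by move=> z _; case: (is_derive_G z).
  - by apply: cvg_at_right_filter; exact: G_cont.
  - by move=> z _; exact: G'E.
rewrite -ge0_integralD//=.
- by apply: eq_integral => z _; rewrite -EFinD; congr EFin; ring.
- by move=> z; rewrite in_itv/= andbT => z1;
    rewrite lee_fin mulr_ge0// subr_ge0 exprn_ege1.
- exact: m_pdf.
- by move=> z _; rewrite lee_fin.
- exact: mpdf.
Qed.

Let second_moment_core :
  (\int[leb]_(z in `[0%R, 1%R]) (z ^+ 2 * pdf z)%:E + (pdf 1)%:E =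
   \int[leb]_(z in `[0%R, 1%R]) (pdf z)%:E)%E.
Proof.
have -> : ((pdf 1)%:E = \int[leb]_(z in `[0%R, 1%R]) (- ((z ^+ 2 - 1) * pdf z))%:E)%E.
  have cN : continuous (fun z : R => - ((z ^+ 2 - 1) * pdf z)).
    move=> z; apply: (@cvgN _ R^o _ _ _ (fun z => (z ^+ 2 - 1) * pdf z)).
    exact: (poly_pdf_cont sqrB1_cont).
  rewrite (@continuous_FTC2 _ _ (\- G)) ?ltr01//.
  - by rewrite /G /= mul1r mul0r !opprK sube0.
  - by apply: continuous_subspaceT.
  - split.
    + by move=> z _; apply: derivableN; case: (is_derive_G z).
    + by apply: cvg_at_right_filter; apply: (@cvgN _ R^o _ _ _ G); exact: G_cont.
    + by apply: cvg_at_left_filter; apply: (@cvgN _ R^o _ _ _ G); exact: G_cont.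
  - move=> z _; rewrite derive1E deriveN; last by case: (is_derive_G z).
    by rewrite -derive1E G'E.
rewrite -ge0_integralD//=.
- by apply: eq_integral => z _; rewrite -EFinD; congr EFin; ring.
- by move=> z _; rewrite lee_fin mulr_ge0// sqr_ge0.
- exact: m_pdf.
- move=> z; rewrite in_itv/= => /andP[z0 z1].
  by rewrite lee_fin -mulNr mulr_ge0// opprB subr_ge0 expr_le1.
- apply/measurable_EFinP; apply: (@measurable_funTS).
  by apply: measurable_funN; apply/measurable_EFinP; exact: m_pdf.
Qed.

Let half_lineE (f : R -> R) : (forall z, 0 <= f z) -> measurable_fun setT f ->
  (\int[leb]_(z in `[0%R, +oo[) (f z)%:E =
   \int[leb]_(z in `[0%R, 1%R]) (f z)%:E + \int[leb]_(z in `[1%R, +oo[) (f z)%:E)%E.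
Proof.
move=> f0 mf.
rewrite -[X in (_ = _ + X)%E]integral_itv_obnd_cbnd; last first.
  exact/measurable_EFinP/measurable_funTS.
rewrite (@itv_bndbnd_setU _ _ _ (BRight 1))//; last by rewrite bnd_simp ler01.
rewrite ge0_integral_setU//=.
- exact/measurable_EFinP/measurable_funTS.
- by move=> z _; rewrite lee_fin.
- apply/disj_setPS => y [/=]; rewrite 2!in_itv/= => /andP[_ yx] /andP[].
  by rewrite ltNge yx.
Qed.

Lemma stdnormal_second_moment : (\int[@stdnormal R]_z (z ^+ 2)%:E = 1)%E.
Proof.
rewrite ge0_integral_normal_prob; last 2 first.
- by move=> z; rewrite lee_fin sqr_ge0.
- by apply/measurable_EFinP; exact: continuous_measurable_fun.
under eq_integral do rewrite -EFinM.
have symhalf (f : R -> R) : (forall z, 0 <= f z) -> continuous f -> f =1 f \o -%R ->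
    (\int[leb]_z (f z)%:E = 2%:E * \int[leb]_(z in `[0%R, +oo[) (f z)%:E)%E.
  by move=> f0 cf ef; rewrite ge0_symfun_integralT// -set_itvcy.
rewrite symhalf; last 3 first.
- by move=> z; rewrite mulr_ge0// sqr_ge0.
- exact: poly_pdf_cont.
- by move=> z; rewrite /= !pdfE sqrrN.
rewrite -(@integral_normal_pdf R 0 1) symhalf//; last first.
  by move=> z; rewrite /= !pdfE sqrrN.
congr (_ * _)%E; rewrite !half_lineE//.
- by rewrite second_moment_tail addeA second_moment_core.
- exact: measurable_normal_pdf.
- by move=> z; rewrite mulr_ge0// sqr_ge0.
- by apply: continuous_measurable_fun; exact: poly_pdf_cont.
Qed.

Let integral_reflection (f : R -> R) : (forall z, 0 <= f z) -> continuous f ->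
  (\int[leb]_z (f z)%:E = \int[leb]_z (f (- z))%:E)%E.
Proof.
have splitE (g : R -> R) : (forall z, 0 <= g z) -> continuous g ->
    (\int[leb]_z (g z)%:E = \int[leb]_(z in `[0%R, +oo[) (g (- z))%:E +
       \int[leb]_(z in `[0%R, +oo[) (g z)%:E)%E.
  move=> g0 cg.
  have mg : measurable_fun setT g by exact: continuous_measurable_fun.
  have -> : (\int[leb]_(z in `[0%R, +oo[) (g (- z))%:E =
      \int[leb]_(z in `]-oo, 0%R]) (g z)%:E)%E.
    rewrite -[X in `]-oo, X]]oppr0 ge0_integration_by_substitutionNy//.
    exact: continuous_subspaceT.
  rewrite -[X in (_ = _ + X)%E]integral_itv_obnd_cbnd; last first.
    exact/measurable_EFinP/measurable_funTS.
  rewrite -ge0_integral_setU//=.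
  - by rewrite -itv_bndbnd_setU// set_itvNyy.
  - exact/measurable_EFinP/measurable_funTS.
  - by move=> z _; rewrite lee_fin.
  - apply/disj_setPS => y [/=]; rewrite 2!in_itv/= => yx /andP[].
    by rewrite ltNge yx.
move=> f0 cf; rewrite (splitE f)// (splitE (fun z => f (- z)))//.
  by rewrite addeC; congr (_ + _)%E; apply: eq_integral => z _; rewrite opprK.
move=> z; apply: (@continuous_comp _ _ _ -%R f); last exact: cf.
by apply: (@cvgN _ R^o _ _ _ id); exact: cvg_id.
Qed.

(** Reflection exchanges the integrals of the positive and negative parts, which
    are finite because [|z| <= 1 + z^2]. *)
Lemma stdnormal_mean : (\int[@stdnormal R]_z (z%:E) = 0)%E.
Proof.
have mid : measurable_fun [set: R] (fun z : R => z%:E).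
  exact/measurable_EFinP.
rewrite integralE.
have posE : (\int[@stdnormal R]_x ((fun z : R => z%:E)^\+ x) =
    \int[leb]_z (Num.max z 0 * pdf z)%:E)%E.
  rewrite ge0_integral_normal_prob//; last exact: measurable_funepos.
  by apply: eq_integral => z _; rewrite funeposE EFinM EFin_max.
have negE : (\int[@stdnormal R]_x ((fun z : R => z%:E)^\- x) =
    \int[leb]_z (Num.max (- z) 0 * pdf z)%:E)%E.
  rewrite ge0_integral_normal_prob//; last exact: measurable_funeneg.
  by apply: eq_integral => z _; rewrite funenegE EFinM EFin_max EFinN.
have cmax : continuous (fun z : R => Num.max z 0).
  by move=> z; apply: continuous_max; [exact: cvg_id|exact: cvg_cst].
have max0 (z : R) : 0 <= Num.max z 0 by rewrite le_max lexx orbT.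
have -> : (\int[@stdnormal R]_x ((fun z : R => z%:E)^\- x) =
    \int[@stdnormal R]_x ((fun z : R => z%:E)^\+ x))%E.
  rewrite posE negE (@integral_reflection (fun z => Num.max z 0 * pdf z)).
  - by apply: eq_integral => z _; rewrite !pdfE sqrrN.
  - by move=> z; rewrite mulr_ge0.
  - exact: poly_pdf_cont.
rewrite subee// ge0_fin_numE; last by apply: integral_ge0.
apply: (@le_lt_trans _ _ (\int[@stdnormal R]_z (1 + (z ^+ 2)%:E))%E).
  apply: ge0_le_integral => //.
  - exact: measurable_funepos.
  - apply: emeasurable_funD => //; apply/measurable_EFinP.
    exact: continuous_measurable_fun.
  - move=> z _; rewrite funeposE -EFin_max -EFinD lee_fin.
    by have := sqr_ge0 (z - 1); rewrite ge_max addr_ge0 ?sqr_ge0// andbT; nra.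
rewrite ge0_integralD//.
- have := expectation_cst (@stdnormal R) 1; rewrite unlock/= => ->.
  by rewrite stdnormal_second_moment -EFinD ltry.
- by move=> z _; rewrite lee_fin sqr_ge0.
- by apply/measurable_EFinP; exact: continuous_measurable_fun.
Qed.

End gaussian_moments.

(** * Square integrable functions and Taylor expansion of expectations *)

Section L2_calculus.
Context {d : measure_display} {T : measurableType d} {R : realType}.
Variable P : probability T R.
Implicit Types f g h : T -> R.

Local Notation L2 := (Lfun P 2%:E).
Local Notation integrable f := (P.-integrable setT (EFin \o f)).

Lemma Rexpectation_cst (c : R) : \int[P]_x c = c.
Proof. by rewrite /Rintegral; have := expectation_cst P c; rewrite unlock/= => ->. Qed.

Lemma L2_measurable f : f \in L2 -> measurable_fun setT f.
Proof. by rewrite inE => /andP[]; rewrite inE. Qed.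

Lemma L2_integrable f : f \in L2 -> integrable f.
Proof.
move=> f2; apply/Lfun1_integrable; apply: Lfun_subset12 f2.
exact: fin_num_measure.
Qed.

Lemma integrable_sub f g : integrable f -> integrable g ->
  integrable (fun x => f x - g x).
Proof. by move=> fi gi; exact: (integrableB measurableT fi gi). Qed.

Lemma integrable_scale (c : R) f : integrable f -> integrable (fun x => c * f x).
Proof. by move=> fi; exact: (integrableZl measurableT c fi). Qed.

Lemma integrable_normr f : integrable f -> integrable (fun x => `|f x|).
Proof. by move=> fi; exact: (integrable_norm fi). Qed.

Lemma L2_mul_integrable f g : f \in L2 -> g \in L2 ->
  integrable (fun x => f x * g x).
Proof. by move=> f2 g2; apply/Lfun1_integrable; exact: Lfun2_mul_Lfun1. Qed.

Lemma L2P f : measurable_fun setT f -> integrable (fun x => f x ^+ 2) -> f \in L2.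
Proof.
move=> mf /integrableP[_ i2]; rewrite inE; apply/andP; split; rewrite inE//=.
rewrite /finite_norm unlock /Lnorm poweR_lty//.
apply: le_lt_trans i2; apply: ge0_le_integral => //=.
- apply/measurable_EFinP; apply: (@measurableT_comp _ _ _ _ _ _ (@powR R ^~ 2)) => //.
  exact: measurableT_comp.
- by apply/measurable_EFinP; apply: measurableT_comp => //; exact: measurable_funX.
- by move=> x _; rewrite lee_fin powR_mulrn// normrX.
Qed.

Lemma L2_sqr_integrable f : f \in L2 -> integrable (fun x => f x ^+ 2).
Proof. exact: Lfun2_integrable_sqr. Qed.

Lemma L2_cst c : (fun=> c) \in L2.
Proof. exact: Lfun_cst. Qed.

Lemma L2D f g : f \in L2 -> g \in L2 -> (fun x => f x + g x) \in L2.
Proof. by move=> f2 g2; have [_] := @Lfun_addr_closed _ _ _ P 2%:E (lee1n 2); exact. Qed.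

Lemma L2Z c f : f \in L2 -> (fun x => c * f x) \in L2.
Proof.
move=> f2; have := @Lfun_scale _ _ _ P f c 2 _ f2.
rewrite (_ : c \o* f = (fun x => c * f x)); last first.
  by apply/funext => x /=; rewrite mulrC.
by apply; rewrite ler1n.
Qed.

Lemma L2B f g : f \in L2 -> g \in L2 -> (fun x => f x - g x) \in L2.
Proof.
move=> f2 g2; have := L2D f2 (L2Z (-1) g2).
by under eq_fun do rewrite mulN1r.
Qed.

Lemma L2_sum n (F : nat -> T -> R) : (forall k, (k < n)%N -> F k \in L2) ->
  (fun x => \sum_(k < n) F k x) \in L2.
Proof.
elim: n => [|n ih] F2.
  by under eq_fun do rewrite big_ord0; exact: L2_cst.
under eq_fun do rewrite big_ord_recr/=.
by apply: L2D; [apply: ih => k kn; apply: F2; rewrite ltnW|exact: F2].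
Qed.

Definition ip f g : R := \int[P]_x (f x * g x).
Definition nrm f : R := Num.sqrt (ip f f).

Lemma ipC f g : ip f g = ip g f.
Proof. by apply: eq_Rintegral => x _; rewrite mulrC. Qed.

Lemma ipDl f g h : f \in L2 -> g \in L2 -> h \in L2 ->
  ip (fun x => f x + g x) h = ip f h + ip g h.
Proof.
move=> f2 g2 h2; rewrite /ip -RintegralD//; last 2 first.
- exact: L2_mul_integrable.
- exact: L2_mul_integrable.
by apply: eq_Rintegral => x _; rewrite mulrDl.
Qed.

Lemma ipDr f g h : f \in L2 -> g \in L2 -> h \in L2 ->
  ip h (fun x => f x + g x) = ip h f + ip h g.
Proof. by move=> *; rewrite ipC ipDl// !(ipC h). Qed.

Lemma ipZl c f h : f \in L2 -> h \in L2 -> ip (fun x => c * f x) h = c * ip f h.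
Proof.
move=> f2 h2; rewrite /ip -RintegralZl//; last exact: L2_mul_integrable.
by apply: eq_Rintegral => x _; rewrite mulrA.
Qed.

Lemma ip_sumr n (F : nat -> T -> R) h : h \in L2 ->
  (forall k, (k < n)%N -> F k \in L2) ->
  ip h (fun x => \sum_(k < n) F k x) = \sum_(k < n) ip h (F k).
Proof.
move=> h2; elim: n => [|n ih] F2.
  rewrite big_ord0 /ip.
  under eq_Rintegral do rewrite big_ord0 mulr0.
  by rewrite Rexpectation_cst.
rewrite big_ord_recr/= -ih; last by move=> k kn; apply: F2; rewrite ltnW.
rewrite -ipDr//; last by exact: F2.
  by apply: eq_Rintegral => x _; rewrite big_ord_recr.
by apply: L2_sum => k kn; apply: F2; rewrite ltnW.
Qed.

Lemma ip_ge0 f : 0 <= ip f f.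
Proof. by apply: Rintegral_ge0 => x _; rewrite -expr2 sqr_ge0. Qed.

Lemma nrm_ge0 f : 0 <= nrm f. Proof. exact: sqrtr_ge0. Qed.

Lemma sqr_nrm f : nrm f ^+ 2 = ip f f.
Proof. by rewrite sqr_sqrtr// ip_ge0. Qed.

Lemma nrm_sqrE f : nrm f ^+ 2 = \int[P]_x (f x ^+ 2).
Proof. by rewrite sqr_nrm; apply: eq_Rintegral => x _; rewrite expr2. Qed.

Lemma eq_nrm f g : f =1 g -> nrm f = nrm g.
Proof. by move=> /funext ->. Qed.

(** The quadratic form [key] below is nonnegative, as it is the squared norm of
    [a f + b g]. *)
Lemma cauchy_schwarz f g : f \in L2 -> g \in L2 -> `|ip f g| <= nrm f * nrm g.
Proof.
move=> f2 g2.
have key (a b : R) : 0 <= a ^+ 2 * ip f f + 2 * (a * b) * ip f g + b ^+ 2 * ip g g.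
  have := ip_ge0 (fun x => a * f x + b * g x).
  have af := L2Z a f2; have bg := L2Z b g2.
  rewrite ipDl ?L2D// !ipDr// !ipZl// !(ipC _ (fun x => _ * _)) !ipZl// (ipC g f).
  by move=> /le_trans; apply; rewrite le_eqVlt; apply/orP; left; apply/eqP; ring.
have ff := ip_ge0 f; have gg := ip_ge0 g.
rewrite -(@ler_pXn2r _ 2)// ?nnegrE ?mulr_ge0 ?nrm_ge0//.
rewrite real_normK ?num_real// exprMn !sqr_nrm.
move: ff; rewrite le_eqVlt => /predU1P[f0|f0].
  have [->|fg0] := eqVneq (ip f g) 0; first by rewrite expr0n/= mulr_ge0// -f0.
  (* f is null: this choice would make the form equal to - ip g g - 2 *)
  have := key (- (ip g g + 1) / ip f g) 1.
  by rewrite -f0 mulr1 -mulrA divfK//; lra.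
have := key (- ip f g) (ip f f).
have -> : (- ip f g) ^+ 2 * ip f f + 2 * (- ip f g * ip f f) * ip f g
   + ip f f ^+ 2 * ip g g = ip f f * (ip f f * ip g g - ip f g ^+ 2) by ring.
by rewrite pmulr_rge0// subr_ge0.
Qed.

Lemma nrmD f g : f \in L2 -> g \in L2 -> nrm (fun x => f x + g x) <= nrm f + nrm g.
Proof.
move=> f2 g2.
rewrite -(@ler_pXn2r _ 2)// ?nnegrE ?addr_ge0 ?nrm_ge0//.
rewrite sqr_nrm sqrrD !sqr_nrm ipDl ?L2D// !ipDr// (ipC g f).
have := ler_norm (ip f g); have := cauchy_schwarz f2 g2; lra.
Qed.

Lemma nrmZ c f : f \in L2 -> nrm (fun x => c * f x) = `|c| * nrm f.
Proof.
move=> f2; rewrite /nrm ipZl// ?L2Z// ipC ipZl// mulrA -expr2 sqrtrM ?sqr_ge0//.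
by rewrite sqrtr_sqr.
Qed.

Lemma nrmB f g : f \in L2 -> g \in L2 -> nrm (fun x => f x - g x) <= nrm f + nrm g.
Proof.
move=> f2 g2; have := nrmD f2 (L2Z (-1) g2).
by rewrite nrmZ// normrN1 mul1r; under eq_fun do rewrite mulN1r.
Qed.

Lemma ler_nrm_dist f g : f \in L2 -> g \in L2 ->
  `|nrm f - nrm g| <= nrm (fun x => f x - g x).
Proof.
move=> f2 g2; have fg2 := L2B f2 g2.
have h1 := nrmD g2 fg2; have h2 := nrmB f2 fg2.
rewrite (@eq_nrm _ f) in h1; last by move=> x; rewrite subrKC.
rewrite (@eq_nrm _ g) in h2; last by move=> x; rewrite subKr.
by rewrite ler_norml; apply/andP; split; lra.
Qed.

Lemma nrm_sum n (F : nat -> T -> R) : (forall k, (k < n)%N -> F k \in L2) ->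
  nrm (fun x => \sum_(k < n) F k x) <= \sum_(k < n) nrm (F k).
Proof.
elim: n => [|n ih] F2.
  rewrite big_ord0 /nrm /ip.
  under eq_Rintegral do rewrite big_ord0 mulr0.
  by rewrite Rexpectation_cst sqrtr0.
have F2' k : (k < n)%N -> F k \in L2 by move=> kn; apply: F2; rewrite ltnW.
rewrite big_ord_recr/=; apply: le_trans (lerD (ih F2') (lexx _)).
rewrite (@eq_nrm _ (fun x => \sum_(k < n) F k x + F n x)); last first.
  by move=> x; rewrite big_ord_recr.
by apply: nrmD; [exact: L2_sum|exact: F2].
Qed.

Lemma integral_normr_le_nrm f : f \in L2 -> \int[P]_x `|f x| <= nrm f.
Proof.
move=> f2.
have af2 : (fun x => `|f x|) \in L2.
  apply: L2P; first by apply: measurableT_comp => //; exact: L2_measurable.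
  have := L2_sqr_integrable f2; congr (P.-integrable _ _).
  by apply/funext => x /=; rewrite real_normK ?num_real.
have := cauchy_schwarz af2 (L2_cst 1).
have -> : ip (fun x => `|f x|) (fun=> 1) = \int[P]_x `|f x|.
  by apply: eq_Rintegral => x _; rewrite mulr1.
have -> : nrm (fun=> 1) = 1.
  by rewrite /nrm /ip Rexpectation_cst mulr1 sqrtr1.
have -> : nrm (fun x => `|f x|) = nrm f.
  rewrite /nrm /ip; congr Num.sqrt; apply: eq_Rintegral => x _.
  by rewrite -expr2 real_normK ?num_real.
by rewrite mulr1; apply: le_trans; exact: ler_norm.
Qed.

Lemma Lnorm2E f : f \in L2 -> ('N[P]_2%:E[EFin \o f] = (nrm f)%:E)%E.
Proof.
move=> f2; rewrite unlock /Lnorm.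
have -> : (\int[P]_x (`|(EFin \o f) x| `^ 2) = (ip f f)%:E)%E.
  rewrite /ip /Rintegral fineK; last first.
    by apply: integrable_fin_num => //; exact: L2_mul_integrable.
  apply: eq_integral => x _; rewrite /= powR_mulrn// real_normK ?num_real//.
by rewrite poweR_EFin /nrm powR12_sqrt// ip_ge0.
Qed.

Lemma bounded_integrable f (M : R) : measurable_fun setT f ->
  (forall x, `|f x| <= M) -> integrable f.
Proof.
move=> mf fM; apply: (@le_integrable _ _ _ _ _ measurableT _ (EFin \o (fun=> M))).
- exact/measurable_EFinP.
- by move=> x _; rewrite lee_fin (le_trans (fM x))// ler_norm.
- exact: finite_measure_integrable_cst.
Qed.

Lemma measurable_lipschitz_test (h0 : R -> R) K f : lipschitz_test h0 K ->
  measurable_fun setT f -> measurable_fun setT (fun x => h0 (f x)).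
Proof.
move=> /lipschitz_test_continuous ch mf.
by apply: measurableT_comp mf; exact: continuous_measurable_fun.
Qed.

Lemma lipschitz_test_integrable (h0 : R -> R) K f : lipschitz_test h0 K ->
  measurable_fun setT f -> integrable (fun x => h0 (f x)).
Proof.
move=> sh mf; apply: (@bounded_integrable _ 1).
  exact: (measurable_lipschitz_test sh mf).
by move=> x; case: sh => /(_ (f x)) /andP[? ?] _; rewrite ger0_norm.
Qed.

Lemma lipschitz_test_expectation_dist (h0 : R -> R) K f g : lipschitz_test h0 K ->
  f \in L2 -> g \in L2 ->
  `|\int[P]_x h0 (f x) - \int[P]_x h0 (g x)| <= K * nrm (fun x => f x - g x).
Proof.
move=> sh f2 g2; have K0 := lipschitz_test_ge0 sh.
have fg2 := L2B f2 g2.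
have mf := L2_measurable f2; have mg := L2_measurable g2.
have hf := lipschitz_test_integrable sh mf; have hg := lipschitz_test_integrable sh mg.
rewrite -RintegralB//; apply: le_trans (le_normr_Rintegral _ _) _ => //.
  exact: integrable_sub.
have afg : integrable (fun x => `|f x - g x|).
  exact: (integrable_normr (L2_integrable fg2)).
apply: (@le_trans _ _ (\int[P]_x (K * `|f x - g x|))); last first.
  rewrite RintegralZl//.
  by rewrite ler_wpM2l// integral_normr_le_nrm.
apply: le_Rintegral => //.
- exact: (integrable_normr (integrable_sub hf hg)).
- exact: (integrable_scale K afg).
- by move=> x _; case: sh => _; apply.
Qed.

Lemma taylor_weight_scaleE (e y : R) :
  taylor_weight (e * y) = e ^+ 2 * (y ^+ 2 * Num.min `|e * y| 1).
Proof. by rewrite /taylor_weight exprMn mulrA. Qed.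

Lemma truncated_sqr_measurable e f : measurable_fun setT f ->
  measurable_fun setT (fun x => f x ^+ 2 * Num.min `|e * f x| 1).
Proof.
move=> mf; apply: measurable_funM; first exact: measurable_funX.
apply: measurable_minr => //; apply: measurableT_comp => //.
exact: measurable_funM.
Qed.

Lemma truncated_sqr_ge0 (e y : R) : 0 <= y ^+ 2 * Num.min `|e * y| 1.
Proof. by rewrite mulr_ge0 ?sqr_ge0// le_min normr_ge0 ler01. Qed.

Lemma truncated_sqr_le (e y : R) : y ^+ 2 * Num.min `|e * y| 1 <= y ^+ 2.
Proof. by rewrite ler_piMr ?sqr_ge0// ge_min lexx orbT. Qed.

Lemma truncated_sqr_integrable e f : f \in L2 ->
  integrable (fun x => f x ^+ 2 * Num.min `|e * f x| 1).
Proof.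
move=> f2; apply: le_integrable (L2_sqr_integrable f2) => //.
  by apply/measurable_EFinP/truncated_sqr_measurable; exact: L2_measurable.
move=> x _; rewrite lee_fin (ger0_norm (truncated_sqr_ge0 _ _)).
by rewrite (ger0_norm (sqr_ge0 _)) truncated_sqr_le.
Qed.

(** Dominated convergence: the integrand is below [f^2] and tends to 0. *)
Lemma truncated_sqr_cvg f (e : nat -> R) : f \in L2 -> e n @[n --> \oo] --> 0 ->
  \int[P]_x (f x ^+ 2 * Num.min `|e n * f x| 1) @[n --> \oo] --> 0.
Proof.
move=> f2 e0.
have mf := L2_measurable f2.
have [] // := @dominated_convergence _ _ _ P setT measurableT
  (fun n x => (f x ^+ 2 * Num.min `|e n * f x| 1)%:E) (fun=> 0%E)
  (EFin \o (fun x => f x ^+ 2)).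
- by move=> n; exact/measurable_EFinP/truncated_sqr_measurable.
- apply: aeW => x _; apply: cvg_EFin; first by near=> n.
  rewrite -[X in _ --> X](mulr0 (f x ^+ 2)); apply: cvgMr.
  apply: (@squeeze_cvgr _ _ _ _ (fun=> 0) (fun n => `|e n * f x|)).
  + by near=> n; rewrite le_min normr_ge0 ler01 ge_min lexx.
  + exact: cvg_cst.
  + rewrite -[X in _ --> X](@normr0 R R); apply: cvg_norm.
    by rewrite -[X in _ --> X](mul0r (f x)); exact: cvgMl.
- exact: L2_sqr_integrable.
- apply: aeW => x n _; rewrite lee_fin ger0_norm ?truncated_sqr_ge0//.
  exact: truncated_sqr_le.
move=> _ _; rewrite integral0 => /fine_cvg; exact.
Unshelve. all: by end_near. Qed.

Section taylor.
Variables (h0 a b : R -> R) (K : R).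
Hypothesis sh : smooth_test h0 K.
Hypothesis taylor_h : forall x y,
  `|h0 (x + y) - h0 x - a x * y - b x * y ^+ 2| <= K * taylor_weight y.

(** The linear term of the expansion disappears because [f] is centred. *)
Lemma expectation_taylor f (e x : R) : f \in L2 -> \int[P]_w f w = 0 ->
  `|\int[P]_w h0 (x + e * f w) - h0 x - b x * (e ^+ 2 * nrm f ^+ 2)|
  <= K * (e ^+ 2 * \int[P]_w (f w ^+ 2 * Num.min `|e * f w| 1)).
Proof.
move=> f2 mean0.
have mf := L2_measurable f2.
have i1 : integrable (fun w => h0 (x + e * f w)).
  apply: (lipschitz_test_integrable sh.1).
  by apply: measurable_funD => //; exact: measurable_funM.
have i2 : integrable (fun w => a x * (e * f w)).
  by apply: L2_integrable; apply: L2Z; exact: L2Z.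
have i3 : integrable (fun w => b x * (e * f w) ^+ 2).
  exact: (integrable_scale (b x) (L2_sqr_integrable (L2Z e f2))).
have i0 : integrable (fun=> h0 x) by exact: finite_measure_integrable_cst.
have i10 := integrable_sub i1 i0.
have i102 := integrable_sub i10 i2.
have i1023 := integrable_sub i102 i3.
have it := truncated_sqr_integrable e f2.
have -> : \int[P]_w h0 (x + e * f w) - h0 x - b x * (e ^+ 2 * nrm f ^+ 2) =
  \int[P]_w (h0 (x + e * f w) - h0 x - a x * (e * f w) - b x * (e * f w) ^+ 2).
  rewrite RintegralB// RintegralB// RintegralB// Rexpectation_cst.
  rewrite RintegralZl//; last by apply: L2_integrable; exact: L2Z.
  rewrite RintegralZl//; last by exact: L2_integrable.
  rewrite mean0 !mulr0 subr0; congr (_ - _).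
  rewrite RintegralZl//; last by apply: L2_sqr_integrable; exact: L2Z.
  congr (_ * _); rewrite nrm_sqrE -RintegralZl//; last exact: L2_sqr_integrable.
  by apply: eq_Rintegral => w _; rewrite exprMn.
apply: le_trans (le_normr_Rintegral _ _) _ => //.
apply: (@le_trans _ _ (\int[P]_w
    ((K * e ^+ 2) * (f w ^+ 2 * Num.min `|e * f w| 1)))); last first.
  by rewrite RintegralZl// mulrA.
apply: le_Rintegral => //.
- exact: (integrable_normr i1023).
- exact: (integrable_scale (K * e ^+ 2) it).
- by move=> w _; rewrite -mulrA -taylor_weight_scaleE.
Qed.
End taylor.

End L2_calculus.

(** The elementary step of Lindeberg's argument: two centred variables with the
    same variance give the same expectations up to the second order, and a
    difference of variances costs at most the curvature bound of [h]. *)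
Lemma one_step_distance (R : realType) d1 d2 (T1 : measurableType d1)
    (T2 : measurableType d2) (P : probability T1 R) (Q : probability T2 R)
    (h : R -> R) (K : R) (f : T1 -> R) (g : T2 -> R) (e s x : R) :
  smooth_test h K ->
  f \in Lfun P 2%:E -> \int[P]_w f w = 0 ->
  g \in Lfun Q 2%:E -> \int[Q]_w g w = 0 ->
  `|\int[P]_w h (x + e * f w) - \int[Q]_w h (x + s * g w)| <=
  K * (`|e ^+ 2 * nrm P f ^+ 2 - s ^+ 2 * nrm Q g ^+ 2|
     + e ^+ 2 * \int[P]_w (f w ^+ 2 * Num.min `|e * f w| 1)
     + s ^+ 2 * \int[Q]_w (g w ^+ 2 * Num.min `|s * g w| 1)).
Proof.
move=> sh f2 f0 g2 g0; have [lh [a [b [bK tay]]]] := sh.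
have := expectation_taylor sh tay e x f2 f0.
have := expectation_taylor sh tay s x g2 g0.
set u := \int[P]_w h _; set v := \int[Q]_w h _.
set p := e ^+ 2 * nrm P f ^+ 2; set q := s ^+ 2 * nrm Q g ^+ 2.
set A := e ^+ 2 * \int[P]_w _; set B := s ^+ 2 * \int[Q]_w _.
have K0 := lipschitz_test_ge0 lh.
have : `|b x * p - b x * q| <= K * `|p - q|.
  by rewrite -mulrBr normrM ler_wpM2r.
rewrite !mulrDr !ler_norml => /andP[? ?] /andP[? ?] /andP[? ?].
by apply/andP; split; lra.
Qed.

(** * The sequence space and its product measure *)

Section sequence_space.
Context {d : measure_display} {E : measurableType d}.
Implicit Types (A : nat -> set E) (p n k : nat).

Lemma measurable_seq_coord k :
  measurable_fun setT (seq_coord k : seq_space E -> E).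
Proof.
move=> _ Y mY; rewrite setTI; apply: sub_sigma_algebra.
by exists k => //; exists Y => //; rewrite setTI.
Qed.

Lemma measurable_fun_seq_space d' (T : measurableType d') (F : T -> seq_space E) :
  (forall k, measurable_fun setT (fun t => F t k)) -> measurable_fun setT F.
Proof.
move=> mF; apply: (@measurability _ _ T (seq_space E) setT F (@coord_preimages d E) erefl).
move=> _ [_ [k _ [B mB <-]] <-].
rewrite !setTI; have := mF k measurableT B mB; rewrite setTI; exact.
Qed.

Lemma measurable_seq_shift : measurable_fun setT (@seq_shift d E).
Proof.
by apply: measurable_fun_seq_space => k; exact: (measurable_seq_coord k.+1).
Qed.

Lemma iter_seq_shift p (x : seq_space E) k : iter p (@seq_shift d E) x k = x (k + p)%N.
Proof. by elim: p k => [|p ih] k; rewrite ?addn0//= /seq_shift ih addSnnS. Qed.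

Lemma measurable_iter_shift p : measurable_fun setT (iter p (@seq_shift d E)).
Proof.
elim: p => [|p ih]; first exact: measurable_id.
exact: (measurableT_comp measurable_seq_shift ih).
Qed.

Definition splice p (u : seq_space E * seq_space E) : seq_space E :=
  fun k => if (k < p)%N then u.1 k else u.2 (k - p)%N.

Lemma measurable_splice p : measurable_fun setT (splice p).
Proof.
apply: measurable_fun_seq_space => k; rewrite /splice; case: (k < p)%N.
  apply: (measurableT_comp (measurable_seq_coord k)). exact: measurable_fst.
exact: (measurableT_comp (measurable_seq_coord (k - p)) measurable_snd).
Qed.

Lemma iter_shift_splice p u : iter p (@seq_shift d E) (splice p u) = u.2.
Proof.
by apply/funext => k; rewrite iter_seq_shift /splice ltnNge leq_addl/= addnK.
Qed.

Definition depends_on_first {U : Type} p (g : seq_space E -> U) :=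
  forall x y : seq_space E, (forall k, (k < p)%N -> x k = y k) -> g x = g y.

Lemma depends_on_first_splice {U : Type} p (g : seq_space E -> U) u :
  depends_on_first p g -> g (splice p u) = g u.1.
Proof. by apply=> k kp; rewrite /splice kp. Qed.

(** Being saturated for agreement on the first [r] coordinates is stable under
    the operations of a sigma-algebra, and the generators are saturated. *)
Lemma coord_sigma_depends_on_first r (A : set (seq_space E)) :
  coord_sigma r A -> depends_on_first r A.
Proof.
suff : coord_sigma r `<=` [set B : set (seq_space E) | depends_on_first r B] by exact.
apply: smallest_sub.
  split => /=.
  - by [].
  - by move=> B dB x y xy; rewrite /setD/= (dB x y xy).
  - move=> F dF x y xy; apply/propext; split => -[i _ Fi]; exists i => //.
      by rewrite -(dF i x y xy).
    by rewrite (dF i x y xy).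
elim/big_ind : _ => [//|B C dB dC|i _]; first by rewrite subUset.
by move=> _ [B mB <-] x y xy; rewrite setTI /seq_coord /preimage/= xy.
Qed.

Definition cylinder A : set (seq_space E) := [set x | forall i, A i (x i)].

Definition finite_support A n := forall i, (n <= i)%N -> A i = setT.

Definition cylinders : set (set (seq_space E)) :=
  [set cylinder A | A in [set A | (forall i, measurable (A i)) /\
                               exists n, finite_support A n]].

Lemma measurable_cylinder A : (forall i, measurable (A i)) -> measurable (cylinder A).
Proof.
move=> mA.
have -> : cylinder A = \bigcap_i (seq_coord i @^-1` A i).
  by apply/seteqP; split => [x Ax i _|x Ax i]; [exact: Ax|exact: Ax].
apply: bigcapT_measurable => i.
by have := measurable_seq_coord i measurableT (mA i); rewrite setTI; exact.
Qed.

Lemma cylinders_setI : setI_closed cylinders.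
Proof.
move=> _ _ [A [mA [n An]] <-] [B [mB [m Bm]] <-].
exists (fun i => A i `&` B i); last first.
  by apply/seteqP; split => [x ABx|x [Ax Bx] i]; split => // i; case: (ABx i).
split; first by move=> i; exact: measurableI.
exists (maxn n m) => i; rewrite geq_max => /andP[ni mi].
by rewrite An// Bm// setTI.
Qed.

Lemma sigma_cylinders (X : set (seq_space E)) : measurable X -> <<s cylinders >> X.
Proof.
apply: smallest_sub; first exact: smallest_sigma_algebra.
move=> _ [k _ [B mB <-]]; apply: sub_sigma_algebra.
exists (fun i => if i == k then B else setT); last first.
  apply/seteqP; split => [x /(_ k)|x [_ Bx] i]; first by rewrite eqxx.
  by case: eqP => // ->.
split; first by move=> i; case: ifP.
by exists k.+1 => i ki; rewrite gtn_eqF.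
Qed.

(** Cylinders are stable under intersection and generate the sigma-algebra. *)
Lemma seq_space_measure_unique (R : realType)
    (m1 m2 : {measure set (seq_space E) -> \bar R}) :
  (m1 setT < +oo)%E ->
  (forall A n, (forall i, measurable (A i)) -> finite_support A n ->
     m1 (cylinder A) = m2 (cylinder A)) ->
  forall X, measurable X -> m1 X = m2 X.
Proof.
move=> m1oo m12 X mX.
apply: (@g_sigma_algebra_measure_unique _ _ _ cylinders _ (fun=> setT)) => //.
- by move=> _ [A [mA _] <-]; exact: measurable_cylinder.
- move=> _; exists (fun=> setT); last by apply/seteqP; split.
  by split => //; exists 0%N.
- by rewrite bigcup_const//; exists 0%N.
- exact: cylinders_setI.
- by move=> _ [A [mA [n An]] <-]; exact: (m12 A n).
- exact: sigma_cylinders.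
Qed.

End sequence_space.

Section product_measure.
Context {d : measure_display} {E : measurableType d} {R : realType}.
Variables (mu : probability E R) (P : probability (seq_space E) R).
Hypothesis hP : is_product_measure mu P.

Lemma product_measure_cylinder (A : nat -> set E) n :
  (forall i, measurable (A i)) -> finite_support A n ->
  (P (cylinder A) = \prod_(i < n) mu (A i))%E.
Proof.
move=> mA An; rewrite -(@hP n (fun i : 'I_n => A i)); last by move=> i; exact: mA.
congr (P _); apply/seteqP; split => [x Ax i _|x Ax i]; first exact: Ax.
have [ni|ni] := leqP n i; first by rewrite An.
exact: (Ax (Ordinal ni)).
Qed.

Let splice_mfun p : {mfun (seq_space E * seq_space E)%type >-> seq_space E} :=
  HB.pack (splice p) (isMeasurableFun.Build _ _ _ _ _ (@measurable_splice d E p)).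

(** It suffices to look at cylinders, whose preimages are rectangles: the first
    [p] conditions bear on the first point and the other ones on the second. *)
Lemma splice_product_measure p (X : set (seq_space E)) : measurable X ->
  (P \x P)%E (splice p @^-1` X) = P X.
Proof.
move=> mX.
pose PP : probability (seq_space E * seq_space E)%type R := (P \x P)%E.
apply/esym.
apply: (@seq_space_measure_unique _ _ R P (distribution PP (splice_mfun p))) => //.
  exact: le_lt_trans (probability_le1 P measurableT) (ltry _).
move=> A n mA An.
rewrite /distribution /pushforward/=.
pose C1 := cylinder (fun i => if (i < p)%N then A i else setT).
pose C2 := cylinder (fun i => A (p + i)%N).
have -> : splice p @^-1` cylinder A = C1 `*` C2.
  apply/seteqP; split => [[x y] Axy|[x y] [Ax Ay] i].
    split => i /=.
      by case: ifP => // ip; have := Axy i; rewrite /splice ip.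
    by have := Axy (p + i)%N; rewrite /splice ltnNge leq_addr/= addKn.
  rewrite /splice; case: ltnP => ip; first by have := Ax i; rewrite ip.
  by have := Ay (i - p)%N; rewrite subnKC.
rewrite (_ : (P \x P)%E (C1 `*` C2) = (P C1 * P C2)%E); last first.
  apply: product_measure1E; apply: measurable_cylinder => i //=.
  by case: (i < p)%N.
rewrite /C1 /C2.
rewrite (@product_measure_cylinder (fun i => if (i < p)%N then A i else setT) p);
  last 2 first.
- by move=> i /=; case: (i < p)%N.
- by rewrite /finite_support => i; rewrite leqNgt => /negbTE ->.
rewrite (@product_measure_cylinder (fun i => A (p + i)%N) n)//; last first.
  by move=> i ni; apply: An; rewrite (leq_trans ni)// leq_addl.
rewrite (@product_measure_cylinder A (p + n))//; last first.
  by move=> i pni; apply: An; rewrite (leq_trans _ pni)// leq_addl.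
rewrite big_split_ord/=; congr (_ * _)%E.
by apply: eq_bigr => i _; rewrite ltn_ord.
Qed.

Let PP : probability (seq_space E * seq_space E)%type R := (P \x P)%E.

Lemma ge0_integral_splice p (F : seq_space E -> \bar R) :
  measurable_fun setT F -> (forall x, 0 <= F x)%E ->
  (\int[P]_x F x = \int[P]_x \int[P]_y F (splice p (x, y)))%E.
Proof.
move=> mF F0.
transitivity (\int[distribution PP (splice_mfun p)]_x F x)%E.
  by apply: eq_measure_integral => X mX _; rewrite -[LHS](splice_product_measure p).
rewrite /distribution ge0_integral_pushforward//=; last exact: measurable_splice.
rewrite preimage_setT (@fubini_tonelli1 _ _ _ _ _ P P (F \o splice p))//.
  by apply: measurableT_comp mF _; exact: measurable_splice.
by move=> u /=; exact: F0.
Qed.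

Lemma integral_splice p (F : seq_space E -> \bar R) :
  P.-integrable setT F ->
  (\int[P]_x F x = \int[P]_x \int[P]_y F (splice p (x, y)))%E.
Proof.
move=> iF; have mF := measurable_int _ iF.
have eqPP A : measurable A -> A `<=` setT -> P A = distribution PP (splice_mfun p) A.
  by move=> mA _; rewrite -[LHS](splice_product_measure p).
have iFS : (P \x P)%E.-integrable setT (F \o splice p).
  apply/integrableP; split.
    by apply: measurableT_comp mF _; exact: measurable_splice.
  have /integrableP[_] := iF; congr (_ < _)%E.
  rewrite (eq_measure_integral _ eqPP) /distribution ge0_integral_pushforward//=.
    exact: measurable_splice.
  exact: measurableT_comp.
rewrite (eq_measure_integral _ eqPP) /distribution integral_pushforward//=.
- by rewrite preimage_setT -(integral12_prod_meas1 iFS).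
- exact: measurable_splice.
Qed.

Let shift_mfun p : {mfun seq_space E >-> seq_space E} :=
  HB.pack (iter p (@seq_shift d E))
    (isMeasurableFun.Build _ _ _ _ _ (@measurable_iter_shift d E p)).

Lemma shift_measure_preserving p (X : set (seq_space E)) : measurable X ->
  P (iter p (@seq_shift d E) @^-1` X) = P X.
Proof.
move=> mX; rewrite -[LHS](splice_product_measure p); last first.
  by rewrite -[X in measurable X]setTI; exact: measurable_iter_shift.
rewrite -[RHS]mul1e -(probability_setT P).
rewrite (_ : splice p @^-1` _ = setT `*` X); first exact: product_measure1E.
apply/seteqP; split => [u/=|u [_]/=]; rewrite iter_shift_splice//.
Qed.

Let shift_distribution p A : measurable A -> A `<=` setT ->
  P A = distribution P (shift_mfun p) A.
Proof. by move=> mA _; rewrite -(shift_measure_preserving p mA). Qed.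

Lemma ge0_integral_shift p (F : seq_space E -> \bar R) :
  measurable_fun setT F -> (forall x, 0 <= F x)%E ->
  (\int[P]_x F (iter p seq_shift x) = \int[P]_x F x)%E.
Proof.
move=> mF F0; apply/esym.
rewrite (eq_measure_integral _ (shift_distribution p)).
by rewrite /distribution ge0_integral_pushforward//=; exact: measurable_iter_shift.
Qed.

Lemma integrable_shift p (F : seq_space E -> \bar R) :
  P.-integrable setT F -> P.-integrable setT (fun x => F (iter p seq_shift x)).
Proof.
move=> iF; have mF := measurable_int _ iF; apply/integrableP; split.
  by apply: measurableT_comp mF _; exact: measurable_iter_shift.
have /integrableP[_] := iF.
by rewrite -(@ge0_integral_shift p (fun x => `|F x|)%E)//; exact: measurableT_comp.
Qed.

Lemma integral_shift p (F : seq_space E -> \bar R) : P.-integrable setT F ->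
  (\int[P]_x F (iter p seq_shift x) = \int[P]_x F x)%E.
Proof.
move=> iF; apply/esym.
rewrite (eq_measure_integral _ (shift_distribution p)).
rewrite /distribution integral_pushforward//=.
- exact: measurable_iter_shift.
- exact: measurable_int iF.
- exact: integrable_shift.
Qed.

Local Notation L2 := (Lfun P 2%:E).

Lemma L2_shift p f : f \in L2 -> (fun x => f (iter p seq_shift x)) \in L2.
Proof.
move=> f2; apply: L2P.
  by apply: measurableT_comp (L2_measurable f2) _; exact: measurable_iter_shift.
exact: (integrable_shift p (L2_sqr_integrable f2)).
Qed.

Lemma Rintegral_shift p (f : seq_space E -> R) : P.-integrable setT (EFin \o f) ->
  \int[P]_x f (iter p seq_shift x) = \int[P]_x f x.
Proof. by move=> fi; rewrite /Rintegral (integral_shift p fi). Qed.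

Lemma ip_shift p f g : f \in L2 -> g \in L2 ->
  ip P (fun x => f (iter p seq_shift x)) (fun x => g (iter p seq_shift x)) = ip P f g.
Proof.
by move=> f2 g2; exact: (Rintegral_shift p (L2_mul_integrable f2 g2)).
Qed.

Lemma nrm_shift p f : f \in L2 -> nrm P (fun x => f (iter p seq_shift x)) = nrm P f.
Proof. by move=> f2; rewrite /nrm ip_shift. Qed.

(** Seen through [splice p], [f] depends on the first point only and the shifted
    [g] on the second one only, so Fubini's theorem separates the integrals. *)
Lemma ip_independent p f g : f \in L2 -> g \in L2 -> depends_on_first p f ->
  ip P f (fun x => g (iter p seq_shift x)) = (\int[P]_x f x) * (\int[P]_x g x).
Proof.
move=> f2 g2 fp; rewrite /ip {1}/Rintegral (@integral_splice p); last first.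
  exact: (L2_mul_integrable f2 (L2_shift p g2)).
have gi := L2_integrable g2; have fi := L2_integrable f2.
under eq_integral => x _.
  under eq_integral => y _.
    rewrite iter_shift_splice/= (depends_on_first_splice _ fp)/= EFinM.
  over.
  rewrite integralZl//=.
over.
rewrite -(fineK (integrable_fin_num measurableT gi)) integralZr//=.
by rewrite fineM// integrable_fin_num.
Qed.

End product_measure.

(** * Averaging operators and Lindeberg's replacement argument *)

Section averages.
Context {d : measure_display} {T : measurableType d} {R : realType}.
Variable P : probability T R.
Implicit Types (f : T -> R) (h : R -> R).

(** Adding independent variables amounts to composing the corresponding
    averages, so that Lindeberg's argument becomes a comparison of products of
    commuting operators. *)
Definition average f h (x : R) : R := \int[P]_w h (x + f w).

Lemma average_integrable f h K x : lipschitz_test h K -> measurable_fun setT f ->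
  P.-integrable setT (EFin \o (fun w => h (x + f w))).
Proof.
move=> lh mf; apply: (lipschitz_test_integrable P lh).
exact: measurable_funD.
Qed.

Lemma EFin_average f h K x : lipschitz_test h K -> measurable_fun setT f ->
  ((average f h x)%:E = \int[P]_w (h (x + f w))%:E)%E.
Proof.
move=> lh mf; rewrite /average /Rintegral fineK//.
by apply: integrable_fin_num => //; exact: (average_integrable x lh).
Qed.

Lemma integral_dist_le h1 h2 K1 K2 (D : R) f :
  lipschitz_test h1 K1 -> lipschitz_test h2 K2 ->
  measurable_fun setT f -> (forall x, `|h1 x - h2 x| <= D) ->
  `|\int[P]_w h1 (f w) - \int[P]_w h2 (f w)| <= D.
Proof.
move=> l1 l2 mf h12.
have i1 := lipschitz_test_integrable P l1 mf.
have i2 := lipschitz_test_integrable P l2 mf.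
rewrite -RintegralB//; apply: le_trans (le_normr_Rintegral _ _) _ => //.
  exact: integrable_sub.
rewrite -[leRHS](Rexpectation_cst P D); apply: le_Rintegral => //.
- exact: (integrable_normr (integrable_sub i1 i2)).
- exact: finite_measure_integrable_cst.
Qed.

Lemma lipschitz_average f h K : lipschitz_test h K -> measurable_fun setT f ->
  lipschitz_test (average f h) K.
Proof.
move=> lh mf; have K0 := lipschitz_test_ge0 lh; split=> [x|x y].
  apply/andP; split; first by apply: Rintegral_ge0 => w _; case: lh => /(_ (x + f w)) /andP[].
  rewrite -[leRHS](Rexpectation_cst P 1); apply: le_Rintegral => //.
  - exact: (average_integrable x lh).
  - exact: finite_measure_integrable_cst.
  - by move=> w _; case: lh => /(_ (x + f w)) /andP[].
have ix := average_integrable x lh mf; have iy := average_integrable y lh mf.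
rewrite /average -RintegralB//; apply: le_trans (le_normr_Rintegral _ _) _ => //.
  exact: integrable_sub.
rewrite -[leRHS](Rexpectation_cst P); apply: le_Rintegral => //.
- exact: (integrable_normr (integrable_sub ix iy)).
- exact: finite_measure_integrable_cst.
- move=> w _; case: lh => _ /(_ (x + f w) (y + f w)).
  by rewrite (_ : x + f w - (y + f w) = x - y)//; ring.
Qed.

End averages.

Lemma average_commute (R : realType) d1 d2 (T1 : measurableType d1)
    (T2 : measurableType d2) (P : probability T1 R) (Q : probability T2 R)
    (f : T1 -> R) (g : T2 -> R) (h : R -> R) (K x : R) :
  lipschitz_test h K -> measurable_fun setT f -> measurable_fun setT g ->
  average P f (average Q g h) x = average Q g (average P f h) x.
Proof.
move=> lh mf mg; rewrite /average /Rintegral; congr fine.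
have h0 z : 0 <= h z by case: lh => /(_ z) /andP[].
have mF : measurable_fun setT (fun u : T1 * T2 => (h (x + f u.1 + g u.2))%:E).
  apply/measurable_EFinP; apply: (measurable_lipschitz_test lh).
  apply: measurable_funD; last exact: (measurableT_comp mg measurable_snd).
  apply: measurable_funD => //; exact: (measurableT_comp mf measurable_fst).
under eq_integral do rewrite -/(average Q g h _) (EFin_average _ _ lh mg).
rewrite (@fubini_tonelli _ _ _ _ _ P Q _ mF); last by move=> u; rewrite lee_fin.
apply: eq_integral => z _; rewrite -/(average P f h _) (EFin_average _ _ lh mf) /=.
by apply: eq_integral => y _; rewrite addrAC.
Qed.

Section std_normal_average.
Context {R : realType}.
Local Notation gamma := (@stdnormal R).

Lemma stdnormal_id_L2 : (fun z : R => z) \in Lfun gamma 2%:E.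
Proof.
apply: L2P => //; apply/integrableP; split.
  by apply/measurable_EFinP; exact: continuous_measurable_fun (@sqr_continuous R).
under eq_integral do rewrite /= ger0_norm ?sqr_ge0//.
by rewrite /= stdnormal_second_moment ltry.
Qed.

Lemma stdnormal_Rmean : \int[gamma]_z z = 0.
Proof. by rewrite /Rintegral stdnormal_mean. Qed.

Lemma nrm_stdnormal : nrm gamma (fun z : R => z) = 1.
Proof.
rewrite /nrm /ip /Rintegral; under eq_integral do rewrite -expr2.
by rewrite stdnormal_second_moment/= sqrtr1.
Qed.

Definition gauss_average (s : R) := average gamma (fun z : R => s * z).

Lemma measurable_scale (s : R) : measurable_fun setT (fun z : R => s * z).
Proof. exact: measurable_funM. Qed.

Lemma gauss_average_semigroup (s t : R) (h : R -> R) (K x : R) :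
  0 < s -> 0 < t -> lipschitz_test h K ->
  gauss_average s (gauss_average t h) x = gauss_average (Num.sqrt (s ^+ 2 + t ^+ 2)) h x.
Proof.
move=> s0 t0 lh; rewrite /gauss_average {1 3}/average /Rintegral; congr fine.
rewrite -stdnormal_convolution//; last 2 first.
- exact: lipschitz_test_continuous lh.
- by move=> y; case: lh => /(_ y) /andP[].
apply: eq_integral => z _.
exact: (EFin_average gamma (x + s * z) lh (measurable_scale t)).
Qed.

End std_normal_average.

Section birkhoff.
Context {U : Type} {R : realType}.
Implicit Types (f : U -> R) (theta : U -> U).

Lemma birkhoff_sum0 f theta x : birkhoff_sum f theta 0 x = 0.
Proof. by rewrite /birkhoff_sum big_ord0. Qed.

Lemma birkhoff_sumS f theta m x :
  birkhoff_sum f theta m.+1 x = f x + birkhoff_sum f theta m (theta x).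
Proof.
rewrite /birkhoff_sum big_ord_recl/=; congr (_ + _).
by apply: eq_bigr => i _; rewrite -iterSr.
Qed.

Lemma birkhoff_sum_add f theta a b x :
  birkhoff_sum f theta (a + b) x =
  birkhoff_sum f theta a x + birkhoff_sum f theta b (iter a theta x).
Proof.
elim: a x => [|a ih] x; first by rewrite birkhoff_sum0 add0r.
by rewrite addSn !birkhoff_sumS ih addrA -iterSr.
Qed.

Lemma birkhoff_sum_blocks f theta p m x :
  birkhoff_sum f theta (m * p) x =
  birkhoff_sum (birkhoff_sum f theta p) (iter p theta) m x.
Proof.
elim: m x => [|m ih] x; first by rewrite mul0n !birkhoff_sum0.
by rewrite mulSn birkhoff_sum_add birkhoff_sumS ih.
Qed.

Lemma birkhoff_sumD f g theta m x :
  birkhoff_sum (fun x => f x + g x) theta m x =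
  birkhoff_sum f theta m x + birkhoff_sum g theta m x.
Proof. exact: big_split. Qed.

End birkhoff.

Section lindeberg.
Context {d : measure_display} {E : measurableType d} {R : realType}.
Variables (mu : probability E R) (P : probability (seq_space E) R).
Hypothesis hP : is_product_measure mu P.
Variables (p : nat) (Y : seq_space E -> R) (h : R -> R) (K : R).
Hypothesis Y2 : Y \in Lfun P 2%:E.
Hypothesis Y0 : \int[P]_x Y x = 0.
Hypothesis Yp : depends_on_first p Y.
Hypothesis sh : smooth_test h K.

Local Notation T := (iter p (@seq_shift d E)).

Lemma L2_birkhoff_sum f q m : f \in Lfun P 2%:E ->
  birkhoff_sum f (iter q (@seq_shift d E)) m \in Lfun P 2%:E.
Proof.
move=> f2; elim: m => [|m ih].
  rewrite (_ : birkhoff_sum _ _ _ = fun=> 0); first exact: L2_cst.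
  by apply/funext => x; rewrite birkhoff_sum0.
rewrite (_ : birkhoff_sum f _ m.+1 =
  fun x => f x + birkhoff_sum f (iter q (@seq_shift d E)) m (iter q (@seq_shift d E) x)).
  by apply: L2D => //; exact: (L2_shift hP q ih).
by apply/funext => x; rewrite birkhoff_sumS.
Qed.

Lemma measurable_block_sum (e : R) m :
  measurable_fun setT (fun x => e * birkhoff_sum Y T m x).
Proof.
by apply: measurable_funM => //; exact: (L2_measurable (L2_birkhoff_sum p m Y2)).
Qed.

Let block_average (e : R) m := average P (fun x => e * birkhoff_sum Y T m x) h.

Let measurable_eY (e : R) : measurable_fun setT (fun x => e * Y x).
Proof. by apply: measurable_funM => //; exact: (L2_measurable Y2). Qed.

(** The first block is independent of the sum of the following ones, which is
    the block sum at the shifted point. *)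
Let block_averageS (e : R) m x :
  block_average e m.+1 x = average P (fun u => e * Y u) (block_average e m) x.
Proof.
have lh := sh.1.
rewrite {1}/block_average {2}/average /average /Rintegral; congr fine.
have h0 z : 0 <= h z by case: lh => /(_ z) /andP[].
rewrite (ge0_integral_splice hP p); last 2 first.
- apply/measurable_EFinP; apply: (measurable_lipschitz_test lh).
  by apply: measurable_funD => //; exact: measurable_block_sum.
- by move=> w; rewrite lee_fin.
apply: eq_integral => u _; rewrite /block_average.
rewrite (EFin_average _ _ lh (measurable_block_sum e m)).
apply: eq_integral => v _; rewrite birkhoff_sumS iter_shift_splice/=.
by rewrite (depends_on_first_splice _ Yp)/= mulrDr addrA.
Qed.

Definition lindeberg_error (e s : R) : R :=
  K * (`|e ^+ 2 * nrm P Y ^+ 2 - s ^+ 2|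
     + e ^+ 2 * \int[P]_w (Y w ^+ 2 * Num.min `|e * Y w| 1)
     + s ^+ 2 * \int[@stdnormal R]_z (z ^+ 2 * Num.min `|s * z| 1)).

(** By induction, with the notation [A] for one block average and [G] for one
    Gaussian average: [A^(m+1) - G^(m+1) = A (A^m - G^m) + (A - G) G^m].  Averages
    do not increase distances, and the last term is [G^m (A - G)] because [A] and
    [G^m] commute; hence only [h] itself has to be expanded, and each replacement
    costs one [lindeberg_error].  The induction starts with one block because the
    semigroup property of the Gaussian averages concerns positive deviations. *)
Lemma lindeberg (e s : R) m x : 0 < s ->
  `|\int[P]_w h (x + e * birkhoff_sum Y T m.+1 w)
    - gauss_average (Num.sqrt m.+1%:R * s) h x| <= m.+1%:R * lindeberg_error e s.
Proof.
move=> s0; have lh := sh.1.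
have one_step y : `|average P (fun u => e * Y u) h y - gauss_average s h y|
    <= lindeberg_error e s.
  have := one_step_distance e s y sh Y2 Y0 stdnormal_id_L2 stdnormal_Rmean.
  by rewrite nrm_stdnormal expr1n mulr1; exact.
rewrite -/(average P _ h x) -/(block_average e m.+1 x).
have lG t := lipschitz_average (@stdnormal R) lh (measurable_scale t).
elim: m x => [|m ih] x.
  rewrite sqrtr1 !mul1r.
  rewrite (_ : block_average e 1 x = average P (fun u => e * Y u) h x); first exact: one_step.
  by apply: eq_Rintegral => w _; rewrite birkhoff_sumS birkhoff_sum0 addr0.
have m0 : 0 < Num.sqrt m.+1%:R * s by rewrite mulr_gt0// sqrtr_gt0.
set t := Num.sqrt m.+1%:R * s in ih m0 *.
have -> : Num.sqrt m.+2%:R * s = Num.sqrt (t ^+ 2 + s ^+ 2).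
  rewrite /t exprMn sqr_sqrtr// -[in RHS](mul1r (s ^+ 2)) mulrA mulr1 -mulrDl.
  by rewrite natr1 sqrtrM// sqrtr_sqr gtr0_norm.
rewrite block_averageS -(gauss_average_semigroup x m0 s0 lh).
have lB := lipschitz_average P lh (measurable_block_sum e m.+1).
have mxY : measurable_fun setT (fun u => x + e * Y u).
  exact: measurable_funD.
have h1 : `|average P (fun u => e * Y u) (block_average e m.+1) x -
            average P (fun u => e * Y u) (gauss_average t h) x|
          <= m.+1%:R * lindeberg_error e s.
  exact: (integral_dist_le P lB (lG t) mxY ih).
have h2 : `|average P (fun u => e * Y u) (gauss_average t h) x -
            gauss_average t (gauss_average s h) x| <= lindeberg_error e s.
  rewrite /gauss_average (average_commute _ _ _ lh)//; last exact: measurable_scale.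
  apply: (integral_dist_le _ (lipschitz_average P lh (measurable_eY e)) (lG s)) => //.
  by apply: measurable_funD => //; exact: measurable_scale.
rewrite -(natr1 m.+1) mulrDl mul1r.
apply: le_trans (lerD h1 h2).
by apply: le_trans (ler_normD _ _); rewrite addrA subrK.
Qed.

End lindeberg.

(** * Decomposition of a Birkhoff sum into blocks *)

Section mean_of_sums.
Context {d : measure_display} {T : measurableType d} {R : realType}.
Variable P : probability T R.

Lemma Rintegral_L2_sum n (F : nat -> T -> R) :
  (forall k, (k < n)%N -> F k \in Lfun P 2%:E) ->
  \int[P]_x (\sum_(k < n) F k x) = \sum_(k < n) \int[P]_x F k x.
Proof.
move=> F2; have := ip_sumr (L2_cst P 1) F2.
rewrite /ip; under eq_Rintegral do rewrite mul1r.
move=> ->; apply: eq_bigr => k _.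
by apply: eq_Rintegral => x _; rewrite mul1r.
Qed.

End mean_of_sums.

Section blocks.
Context {d : measure_display} {E : measurableType d} {R : realType}.
Variables (mu : probability E R) (P : probability (seq_space E) R).
Hypothesis hP : is_product_measure mu P.

Local Notation theta := (@seq_shift d E).
Local Notation L2 := (Lfun P 2%:E).
Local Notation N := (nrm P).

Lemma depends_on_first_iter_shift q k (g : seq_space E -> R) :
  depends_on_first (q - k) g -> (k < q)%N ->
  depends_on_first q (fun x => g (iter k theta x)).
Proof.
move=> dg kq x y xy; apply: dg => i ik; rewrite !iter_seq_shift; apply: xy; lia.
Qed.

Lemma depends_on_first_le p q (g : seq_space E -> R) : (p <= q)%N ->
  depends_on_first p g -> depends_on_first q g.
Proof. by move=> pq dg x y xy; apply: dg => i ip; apply: xy; exact: leq_trans pq. Qed.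

Lemma depends_on_first_sum q n (F : nat -> seq_space E -> R) :
  (forall k, (k < n)%N -> depends_on_first q (F k)) ->
  depends_on_first q (fun x => \sum_(k < n) F k x).
Proof. by move=> dF x y xy; apply: eq_bigr => k _; apply: (dF k). Qed.

Lemma nrm_birkhoff_sum_le f n : f \in L2 -> N (birkhoff_sum f theta n) <= n%:R * N f.
Proof.
move=> f2; apply: le_trans (@nrm_sum _ _ _ P n (fun k x => f (iter k theta x)) _) _.
  by move=> k _; exact: (L2_shift hP k f2).
under eq_bigr do rewrite (nrm_shift hP)//.
by rewrite sumr_const card_ord mulr_natl.
Qed.

Lemma sqr_nrm_birkhoff_sumS q m f : f \in L2 ->
  N (birkhoff_sum f (iter q theta) m.+1) ^+ 2 =
  N f ^+ 2 + N (birkhoff_sum f (iter q theta) m) ^+ 2 +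
  2 * \sum_(j < m) ip P f (fun x => f (iter (j.+1 * q) theta x)).
Proof.
move=> f2; set B := birkhoff_sum f (iter q theta) m.
have B2 : B \in L2 by exact: (L2_birkhoff_sum hP).
have BT2 : (fun x => B (iter q theta x)) \in L2 by exact: (L2_shift hP).
rewrite (@eq_nrm _ _ _ _ _ (fun x => f x + B (iter q theta x))); last first.
  by move=> x; rewrite birkhoff_sumS.
have -> : \sum_(j < m) ip P f (fun x => f (iter (j.+1 * q) theta x)) =
    ip P f (fun x => B (iter q theta x)).
  rewrite -(@ip_sumr _ _ _ _ _ (fun j x => f (iter (j.+1 * q) theta x)))//; last first.
    by move=> k _; exact: (L2_shift hP).
  apply: eq_Rintegral => x _; congr (_ * _); apply: eq_bigr => j _.
  by rewrite mulSn addnC iterD iterM.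
rewrite !sqr_nrm ipDl ?L2D// !ipDr// (ipC _ _ f) (ip_shift hP q B2 B2); ring.
Qed.

Section approximation.
Variables (f : seq_space E -> R) (fr : nat -> seq_space E -> R) (C : R).
Hypothesis f2 : f \in L2.
Hypothesis f0 : \int[P]_x f x = 0.
Hypothesis fr2 : forall r, (0 < r)%N -> fr r \in L2.
Hypothesis fr0 : forall r, (0 < r)%N -> \int[P]_x fr r x = 0.
Hypothesis fr_dep : forall r, (0 < r)%N -> depends_on_first r (fr r).
Let c k := N (fun x => f x - fr k.+1 x).
Hypothesis hC : forall n, \sum_(k < n) c k <= C.

(** Each term of the Birkhoff sum of length [p] is conditioned on those of its
    coordinates that lie among the first [p] ones. *)
Definition block p (x : seq_space E) : R := \sum_(k < p) fr (p - k) (iter k theta x).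

(** The error made when the window of conditioning has length [q] instead; the
    windows [q > p] serve to decorrelate the errors of different blocks. *)
Definition defect q p (x : seq_space E) : R :=
  \sum_(k < p) (f (iter k theta x) - fr (q - k) (iter k theta x)).

Lemma birkhoff_sum_block_defect p x :
  birkhoff_sum f theta p x = block p x + defect p p x.
Proof. by rewrite /block /defect -big_split/=; apply: eq_bigr => k _; rewrite subrKC. Qed.

Let fr_shift2 q k : (k < q)%N -> (fun x => fr (q - k) (iter k theta x)) \in L2.
Proof. by move=> kq; apply: (L2_shift hP); apply: fr2; rewrite subn_gt0. Qed.

Let f_shift2 k : (fun x => f (iter k theta x)) \in L2.
Proof. exact: (L2_shift hP). Qed.

Lemma block_L2 p : block p \in L2.
Proof.
by apply: (@L2_sum _ _ _ P p (fun k x => fr (p - k) (iter k theta x))); exact: fr_shift2.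
Qed.

Lemma block_mean p : \int[P]_x block p x = 0.
Proof.
rewrite (@Rintegral_L2_sum _ _ _ P p (fun k x => fr (p - k) (iter k theta x)));
  last by exact: fr_shift2.
apply: big1 => k _; rewrite (Rintegral_shift hP).
  by rewrite fr0// subn_gt0.
by apply: L2_integrable; apply: fr2; rewrite subn_gt0.
Qed.

Lemma block_depends p : depends_on_first p (block p).
Proof.
apply: (@depends_on_first_sum p p (fun k x => fr (p - k) (iter k theta x))) => k kp.
by apply: depends_on_first_iter_shift => //; apply: fr_dep; rewrite subn_gt0.
Qed.

Lemma defect_L2 q p : (p <= q)%N -> defect q p \in L2.
Proof.
move=> pq.
apply: (@L2_sum _ _ _ P p (fun k x => f (iter k theta x) - fr (q - k) (iter k theta x))).
by move=> k kp; apply: L2B => //; apply: fr_shift2; exact: leq_trans pq.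
Qed.

Lemma defect_mean p : \int[P]_x defect p p x = 0.
Proof.
rewrite (@Rintegral_L2_sum _ _ _ P p
  (fun k x => f (iter k theta x) - fr (p - k) (iter k theta x))); last first.
  by move=> k kp; apply: L2B => //; exact: fr_shift2.
apply: big1 => k _.
rewrite RintegralB//; last 2 first.
- by apply: L2_integrable.
- by apply: L2_integrable; exact: fr_shift2.
rewrite (Rintegral_shift hP); last exact: L2_integrable.
rewrite (Rintegral_shift hP); last by apply: L2_integrable; apply: fr2; rewrite subn_gt0.
by rewrite f0 fr0 ?subn_gt0// subrr.
Qed.

Lemma nrm_defect p j : N (defect (j * p + p) p) <= \sum_(k < p) c (j * p + k).
Proof.
apply: le_trans (@nrm_sum _ _ _ P p (fun k x => f (iter k theta x) -
   fr (j * p + p - k) (iter k theta x)) _) _.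
  by move=> k kp; apply: L2B => //; apply: fr_shift2; lia.
(* read backwards, the lengths of the windows increase *)
rewrite (reindex_inj rev_ord_inj)/= le_eqVlt; apply/orP; left; apply/eqP.
apply: eq_bigr => k _; have kp := ltn_ord k.
rewrite /c (_ : (j * p + p - (p - k.+1) = (j * p + k).+1)%N); last by lia.
rewrite (nrm_shift hP (p - k.+1) (f := fun x => f x - fr (j * p + k).+1 x))//.
by apply: L2B => //; exact: fr2.
Qed.

Lemma nrm_defect_le p : N (defect p p) <= C.
Proof. by apply: le_trans (hC p); have := nrm_defect p 0. Qed.

(** The difference [g] between the defects for the windows [p] and [q] depends on
    the first [q] coordinates only, hence is uncorrelated with the defect shifted
    by [q]; there remains the defect for the window [q], which is small. *)
Lemma ip_defect_shift p j :
  `|ip P (defect p p) (fun x => defect p p (iter (j.+1 * p) theta x))|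
  <= C * \sum_(k < p) c (j * p + k).
Proof.
pose q := (j * p + p)%N.
have qE : (j.+1 * p = q)%N by rewrite mulSn addnC.
have pq : (p <= q)%N by rewrite leq_addl.
pose g (x : seq_space E) : R :=
  \sum_(k < p) (fr (q - k) (iter k theta x) - fr (p - k) (iter k theta x)).
have g2 : g \in L2.
  apply: (@L2_sum _ _ _ P p
    (fun k x => fr (q - k) (iter k theta x) - fr (p - k) (iter k theta x))) => k kp.
  by apply: L2B; apply: fr_shift2 => //; exact: leq_trans pq.
have g_dep : depends_on_first q g.
  apply: (@depends_on_first_sum q p
    (fun k x => fr (q - k) (iter k theta x) - fr (p - k) (iter k theta x))) => k kp.
  have kq := leq_trans kp pq.
  have d1 : depends_on_first q (fun x => fr (q - k) (iter k theta x)).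
    by apply: depends_on_first_iter_shift => //; apply: fr_dep; rewrite subn_gt0.
  have d2 : depends_on_first q (fun x => fr (p - k) (iter k theta x)).
    apply: (depends_on_first_le pq).
    by apply: depends_on_first_iter_shift => //; apply: fr_dep; rewrite subn_gt0.
  by move=> x y xy; rewrite (d1 x y xy) (d2 x y xy).
have W2 : defect p p \in L2 by exact: defect_L2.
have WT2 : (fun x => defect p p (iter q theta x)) \in L2 by exact: (L2_shift hP).
have D2 : defect q p \in L2 by exact: defect_L2.
have -> : ip P (defect p p) (fun x => defect p p (iter (j.+1 * p) theta x)) =
  ip P (defect q p) (fun x => defect p p (iter q theta x)).
  rewrite qE -[RHS]addr0.
  have <- : ip P g (fun x => defect p p (iter q theta x)) = 0.
    by rewrite (ip_independent hP)// defect_mean mulr0.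
  rewrite -ipDl//; apply: eq_Rintegral => x _; congr (_ * _).
  rewrite /defect /g -big_split/=; apply: eq_bigr => k _; ring.
apply: le_trans (cauchy_schwarz D2 WT2) _.
rewrite mulrC (nrm_shift hP)// ler_pM ?nrm_ge0//.
- exact: nrm_defect_le.
- exact: nrm_defect.
Qed.

Lemma sum_blocks (a : nat -> R) p m :
  \sum_(j < m) \sum_(k < p) a (j * p + k)%N = \sum_(i < m * p) a i.
Proof.
elim: m => [|m ih]; first by rewrite big_ord0 mul0n big_ord0.
by rewrite big_ord_recr/= ih mulSn addnC big_split_ord.
Qed.

(** Adding one more block adds its squared norm, at most [C^2], and twice its
    correlations with the other ones, at most [C] times disjoint pieces of the
    series bounded by [C].  The growth is thus linear in [m], with a constant
    that does not depend on the length [p]. *)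
Lemma sqr_nrm_defect_sum p m :
  N (birkhoff_sum (defect p p) (iter p theta) m) ^+ 2 <= m%:R * (3 * C ^+ 2).
Proof.
have C0 : 0 <= C by apply: le_trans (hC 0); rewrite big_ord0.
have W2 : defect p p \in L2 by exact: defect_L2.
elim: m => [|m ih].
  rewrite mul0r (@eq_nrm _ _ _ _ _ (fun=> 0)); last by move=> x; rewrite birkhoff_sum0.
  by rewrite nrm_sqrE expr0n/= Rexpectation_cst.
rewrite sqr_nrm_birkhoff_sumS//.
have h1 : N (defect p p) ^+ 2 <= C ^+ 2.
  by rewrite ler_pXn2r ?nnegrE ?nrm_ge0// nrm_defect_le.
have h2 : \sum_(j < m) ip P (defect p p)
    (fun x => defect p p (iter (j.+1 * p) theta x)) <= C ^+ 2.
  apply: (@le_trans _ _ (\sum_(j < m) C * \sum_(k < p) c (j * p + k))).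
    by apply: ler_sum => j _; apply: le_trans (ip_defect_shift p j); exact: ler_norm.
  by rewrite -mulr_sumr sum_blocks expr2 ler_wpM2l.
rewrite -natr1; lra.
Qed.

(** Unlike the defects, the blocks are exactly uncorrelated. *)
Lemma sqr_nrm_block_sum p m :
  N (birkhoff_sum (block p) (iter p theta) m) ^+ 2 = m%:R * N (block p) ^+ 2.
Proof.
have Y2 := block_L2 p.
elim: m => [|m ih].
  rewrite mul0r (@eq_nrm _ _ _ _ _ (fun=> 0)); last by move=> x; rewrite birkhoff_sum0.
  by rewrite nrm_sqrE expr0n/= Rexpectation_cst.
rewrite sqr_nrm_birkhoff_sumS// ih big1 ?mulr0 ?addr0 -?natr1 ?mulrDl ?mul1r 1?addrC//.
move=> j _.
rewrite (ip_independent hP) ?block_mean ?mul0r//.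
apply: (depends_on_first_le _ (block_depends (p := p))).
by rewrite mulSn leq_addr.
Qed.

End approximation.
End blocks.

(** * Asymptotic variance and convergence of smooth expectations *)

Lemma cvg_inv_sqrt (R : realType) : (Num.sqrt n%:R)^-1 @[n --> \oo] --> (0 : R).
Proof.
apply/cvgrPdist_le => e e0; near=> n.
have n0 : (0 < n)%N by near: n; exact: nbhs_infty_gt.
have en : e ^- 2 <= n%:R.
  by near: n; exact: nbhs_infty_ger.
rewrite sub0r normrN ger0_norm ?invr_ge0 ?sqrtr_ge0//.
rewrite invf_ple ?posrE ?sqrtr_gt0 ?ltr0n//.
by rewrite -[leLHS]ger0_norm ?invr_ge0 ?(ltW e0)// -sqrtr_sqr exprVn ler_wsqrtr.
Unshelve. all: by end_near. Qed.

Section block_approximation.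
Context {d : measure_display} {E : measurableType d} {R : realType}.
Variables (mu : probability E R) (P : probability (seq_space E) R).
Hypothesis hP : is_product_measure mu P.
Local Notation theta := (@seq_shift d E).
Local Notation L2 := (Lfun P 2%:E).
Local Notation N := (nrm P).

Variables (f : seq_space E -> R) (fr : nat -> seq_space E -> R) (C : R).
Hypothesis f2 : f \in L2.
Hypothesis f0 : \int[P]_x f x = 0.
Hypothesis fr2 : forall r, (0 < r)%N -> fr r \in L2.
Hypothesis fr0 : forall r, (0 < r)%N -> \int[P]_x fr r x = 0.
Hypothesis fr_dep : forall r, (0 < r)%N -> depends_on_first r (fr r).
Hypothesis hC : forall n, \sum_(k < n) N (fun x => f x - fr k.+1 x) <= C.

Definition normalized_sum n x : R := (Num.sqrt n%:R)^-1 * birkhoff_sum f theta n x.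

Definition block_sum p m x : R :=
  (Num.sqrt (m * p)%:R)^-1 * birkhoff_sum (block fr p) (iter p theta) m x.

(** The standard deviation of a block per square root of time. *)
Definition block_sd p : R := N (block fr p) / Num.sqrt p%:R.

Lemma normalized_sum_L2 n : normalized_sum n \in L2.
Proof. by apply: L2Z; exact: (L2_birkhoff_sum hP 1). Qed.

Lemma block_sum_L2 p m : block_sum p m \in L2.
Proof.
by apply: L2Z; apply: (L2_birkhoff_sum hP); exact: (block_L2 hP fr2).
Qed.

Lemma nrm_block_birkhoff p m : (0 < p)%N ->
  N (birkhoff_sum (block fr p) (iter p theta) m) = Num.sqrt (m * p)%:R * block_sd p.
Proof.
move=> p0; have p0R : 0 < Num.sqrt p%:R :> R by rewrite sqrtr_gt0 ltr0n.
rewrite natrM sqrtrM ?ler0n// /block_sd mulrACA divff ?gt_eqF// mulr1.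
apply/eqP; rewrite -(@eqrXn2 _ 2)// ?nrm_ge0 ?mulr_ge0 ?sqrtr_ge0 ?nrm_ge0//.
by rewrite (sqr_nrm_block_sum hP fr2 fr0 fr_dep) exprMn (@sqr_sqrtr _ m%:R).
Qed.

Lemma nrm_block_sum p m : (0 < p)%N -> (0 < m)%N -> N (block_sum p m) = block_sd p.
Proof.
move=> p0 m0; rewrite nrmZ; last first.
  by apply: (L2_birkhoff_sum hP); exact: (block_L2 hP fr2).
rewrite nrm_block_birkhoff// ger0_norm ?invr_ge0 ?sqrtr_ge0// mulrA mulVf ?mul1r//.
by rewrite gt_eqF// sqrtr_gt0 ltr0n muln_gt0 m0.
Qed.

(** With [n = m p + q] and [q < p], the three terms account for the defects of the
    [m] blocks, for the last [q] terms of the sum, and for the normalization by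
    [sqrt (m p)] in place of [sqrt n]. *)
Lemma normalized_sum_block_dist p n : (0 < p)%N -> (p <= n)%N ->
  N (fun x => normalized_sum n x - block_sum p (n %/ p) x) <=
  Num.sqrt (3 * C ^+ 2) / Num.sqrt p%:R + p%:R * N f / Num.sqrt n%:R
    + p%:R / n%:R * block_sd p.
Proof.
move=> p0 pn; set m := (n %/ p)%N; set q := (n %% p)%N.
have nE : n = (m * p + q)%N by exact: divn_eq.
have m0 : (0 < m)%N by rewrite divn_gt0.
have n0 : (0 < n)%N by exact: leq_trans pn.
have n0R : 0 < Num.sqrt n%:R :> R by rewrite sqrtr_gt0 ltr0n.
have p0R : 0 < Num.sqrt p%:R :> R by rewrite sqrtr_gt0 ltr0n.
have mp0R : 0 < Num.sqrt (m * p)%:R :> R by rewrite sqrtr_gt0 ltr0n muln_gt0 m0.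
pose BY := birkhoff_sum (block fr p) (iter p theta) m.
pose BW := birkhoff_sum (defect f fr p p) (iter p theta) m.
pose tail x := birkhoff_sum f theta q (iter (m * p) theta x).
have BY2 : BY \in L2 by apply: (L2_birkhoff_sum hP); exact: (block_L2 hP fr2).
have BW2 : BW \in L2 by apply: (L2_birkhoff_sum hP); exact: (defect_L2 hP f2 fr2).
have Sq2 : birkhoff_sum f theta q \in L2 by exact: (L2_birkhoff_sum hP 1).
have tail2 : tail \in L2 by exact: (L2_shift hP (m * p) Sq2).
set a := (Num.sqrt n%:R)^-1 : R; set b := (Num.sqrt (m * p)%:R)^-1 : R.
have a0 : 0 < a by rewrite invr_gt0.
have SE x : birkhoff_sum f theta n x = BY x + BW x + tail x.
  rewrite {1}nE birkhoff_sum_add birkhoff_sum_blocks -birkhoff_sumD; congr (_ + _).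
  by apply: eq_bigr => k _; rewrite (birkhoff_sum_block_defect _ fr).
rewrite (@eq_nrm _ _ _ _ _ (fun x => a * BW x + a * tail x + (a - b) * BY x)); last first.
  by move=> x; rewrite /normalized_sum /block_sum SE -/BY -/a -/b; ring.
have aBW2 := L2Z a BW2; have atail2 := L2Z a tail2; have abBY2 := L2Z (a - b) BY2.
apply: le_trans (nrmD (L2D aBW2 atail2) abBY2) _; apply: lerD; last first.
  rewrite nrmZ// nrm_block_birkhoff// mulrA ler_wpM2r ?divr_ge0 ?nrm_ge0 ?sqrtr_ge0//.
  set r := Num.sqrt (m * p)%:R * a.
  (* r^2 <= r since r <= 1, so a lower bound on r^2 is one on r *)
  have -> : `|a - b| * Num.sqrt (m * p)%:R = `|r - 1|.
    rewrite -[X in _ * X](gtr0_norm mp0R) -normrM mulrBl mulVf ?gt_eqF//.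
    by rewrite mulrC.
  have r0 : 0 <= r by rewrite mulr_ge0 ?sqrtr_ge0// ltW.
  have r2 : r ^+ 2 = (m * p)%:R / n%:R.
    by rewrite exprMn exprVn !sqr_sqrtr ?ler0n.
  have r1 : r ^+ 2 <= 1.
    by rewrite r2 ler_pdivrMr ?ltr0n// mul1r ler_nat nE leq_addr.
  have r1' : r <= 1 by rewrite -(@expr_le1 _ 2).
  have rlow : 1 - p%:R / n%:R <= r ^+ 2.
    rewrite r2 lerBlDr -mulrDl ler_pdivlMr ?ltr0n// mul1r -natrD ler_nat nE.
    by rewrite leq_add2l ltnW// ltn_pmod.
  rewrite distrC ger0_norm ?subr_ge0//.
  have : r ^+ 2 <= r by rewrite expr2 ler_piMl.
  lra.
apply: le_trans (nrmD aBW2 atail2) _; apply: lerD; rewrite nrmZ// (gtr0_norm a0).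
  rewrite /a mulrC ler_pdivrMr// mulrAC ler_pdivlMr//.
  have C2 : 0 <= 3 * C ^+ 2 by rewrite mulr_ge0 ?sqr_ge0.
  rewrite -(@ler_pXn2r _ 2)// ?nnegrE ?mulr_ge0 ?nrm_ge0 ?sqrtr_ge0//.
  rewrite 2!exprMn (sqr_sqrtr C2) (@sqr_sqrtr _ p%:R)// (@sqr_sqrtr _ n%:R)//.
  have := sqr_nrm_defect_sum hP f2 f0 fr2 fr0 fr_dep hC p m.
  rewrite -/BW => hBW.
  apply: le_trans (ler_wpM2r (ler0n _ p) hBW) _.
  rewrite mulrAC -natrM mulrC ler_wpM2l//.
  by rewrite ler_nat nE leq_addr.
rewrite mulrC ler_wpM2r ?(ltW a0)//.
rewrite (nrm_shift hP (m * p) Sq2).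
apply: le_trans (nrm_birkhoff_sum_le hP q f2) _.
by rewrite ler_wpM2r ?nrm_ge0// ler_nat ltnW// ltn_pmod.
Qed.

Lemma normalized_sum_block_approx (e : R) : 0 < e -> exists2 p, (0 < p)%N &
  \forall n \near \oo,
    N (fun x => normalized_sum n x - block_sum p (n %/ p) x) <= e.
Proof.
move=> e0; set A := Num.sqrt (3 * C ^+ 2).
have A0 : 0 <= A by exact: sqrtr_ge0.
have cs := @cvg_inv_sqrt R.
have [p p0 pe] : exists2 p, (0 < p)%N & A / Num.sqrt p%:R <= e / 3.
  have : A / Num.sqrt n%:R @[n --> \oo] --> A * 0 by exact: cvgMr.
  rewrite mulr0 => /cvgrPdist_le /(_ (e / 3)) [|M _ HM].
    by rewrite divr_gt0.
  exists M.+1 => //; have := HM M.+1 (leqnSn _).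
  by rewrite /= sub0r normrN; apply: le_trans; exact: ler_norm.
exists p => //.
have c1 : p%:R * N f / Num.sqrt n%:R @[n --> \oo] --> (0 : R).
  by rewrite -[X in _ --> X](mulr0 (p%:R * N f)); exact: cvgMr.
have c2 : p%:R / n%:R * block_sd p @[n --> \oo] --> (0 : R).
  rewrite -[X in _ --> X](mulr0 (p%:R * block_sd p * 0)).
  have rE n : p%:R / n%:R * block_sd p =
      p%:R * block_sd p * (Num.sqrt n%:R)^-1 * (Num.sqrt n%:R)^-1.
    by rewrite -[in LHS](@sqr_sqrtr R n%:R) ?ler0n// expr2 invfM; ring.
  under eq_fun do rewrite rE.
  by apply: cvgM => //; exact: cvgMr.
have e3 : 0 < e / 3 by rewrite divr_gt0.
near=> n.
have pn : (p <= n)%N by near: n; exact: nbhs_infty_ge.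
apply: le_trans (normalized_sum_block_dist p0 pn) _.
have h1 : p%:R * N f / Num.sqrt n%:R <= e / 3.
  apply: le_trans (ler_norm _) _; rewrite -normrN -[X in `|X|]sub0r.
  by near: n; move/cvgrPdist_le : c1; apply.
have h2 : p%:R / n%:R * block_sd p <= e / 3.
  apply: le_trans (ler_norm _) _; rewrite -normrN -[X in `|X|]sub0r.
  by near: n; move/cvgrPdist_le : c2; apply.
rewrite -/A; lra.
Unshelve. all: by end_near. Qed.

Lemma nrm_normalized_sum_approx (e : R) p n : (0 < p)%N -> (p <= n)%N ->
  N (fun x => normalized_sum n x - block_sum p (n %/ p) x) <= e ->
  `|N (normalized_sum n) - block_sd p| <= e.
Proof.
move=> p0 pn; apply: le_trans.
rewrite -(nrm_block_sum p0 (m := n %/ p)); last by rewrite divn_gt0.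
by apply: ler_nrm_dist; [exact: normalized_sum_L2|exact: block_sum_L2].
Qed.

(** The norm of the block sum does not depend on [n], so the approximation by
    blocks shows that the sequence is Cauchy. *)
Lemma nrm_normalized_sum_cvg :
  cvg (N (normalized_sum n) @[n --> \oo]).
Proof.
apply/cauchy_cvgP/cauchy_exP => e e0.
have e2 : 0 < e / 2 by rewrite divr_gt0.
have [p p0 Hp] := normalized_sum_block_approx e2.
exists (block_sd p).
suff : \forall n \near \oo, ball (block_sd p) e (N (normalized_sum n)) by [].
near=> n; rewrite /ball/= distrC.
apply: (@le_lt_trans _ _ (e / 2)); last by lra.
apply: nrm_normalized_sum_approx => //.
  by near: n; exact: nbhs_infty_ge.
by near: n.
Unshelve. all: by end_near. Qed.

Definition asymptotic_sd : R := lim (N (normalized_sum n) @[n --> \oo]).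
Local Notation sigma := asymptotic_sd.

Lemma asymptotic_sd_cvg : N (normalized_sum n) @[n --> \oo] --> sigma.
Proof. exact: nrm_normalized_sum_cvg. Qed.

Lemma asymptotic_sd_ge0 : 0 <= sigma.
Proof.
apply: limr_ge; first exact: nrm_normalized_sum_cvg.
by near=> n; exact: nrm_ge0.
Unshelve. all: by end_near. Qed.

Lemma block_sd_close (e : R) p : 0 < e -> (0 < p)%N ->
  (\forall n \near \oo,
    N (fun x => normalized_sum n x - block_sum p (n %/ p) x) <= e) ->
  `|block_sd p - sigma| <= 2 * e.
Proof.
move=> e0 p0 Hp.
near \oo => n.
have h1 : `|N (normalized_sum n) - block_sd p| <= e.
  apply: nrm_normalized_sum_approx => //.
    by near: n; exact: nbhs_infty_ge.
  by near: n.
have h2 : `|sigma - N (normalized_sum n)| <= e.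
  by near: n; move/cvgrPdist_le : asymptotic_sd_cvg; apply.
move: h1 h2; rewrite !ler_norml => /andP[? ?] /andP[? ?].
by apply/andP; split; lra.
Unshelve. all: by end_near. Qed.

Section test_function.
Variables (h : R -> R) (K : R).
Hypothesis sh : smooth_test h K.
Hypothesis sigma0 : 0 < sigma.

(** With [m] blocks the one-step error is multiplied by [m], and both the scale of
    a block and the deviation of the replacing Gaussian variable are of order
    [1 / sqrt m]: the truncated second moments then tend to 0, and the difference
    of variances is all that remains. *)
Lemma block_sum_test_dist (e : R) p : 0 < e -> (0 < p)%N ->
  \forall m \near \oo,
  `|\int[P]_x h (block_sum p m x) - gauss_average sigma h 0| <=
  K * (`|block_sd p ^+ 2 - sigma ^+ 2| + e).
Proof.
move=> e0 p0.
have K0 := lipschitz_test_ge0 sh.1.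
pose eps m : R := (Num.sqrt (m * p)%:R)^-1.
(* m Gaussian variables of deviation s m add up to one of deviation sigma *)
pose s m : R := sigma / Num.sqrt m%:R.
have Y2 := block_L2 hP fr2 p.
have p0R : 0 < p%:R :> R by rewrite ltr0n.
have eps0 : eps n @[n --> \oo] --> 0.
  have -> : eps = (fun n => (Num.sqrt p%:R)^-1 * (Num.sqrt n%:R)^-1).
    apply/funext => n; rewrite /eps natrM sqrtrM ?ler0n// invfM mulrC//.
  rewrite -[X in _ --> X](mulr0 (Num.sqrt p%:R)^-1); apply: cvgMr.
  exact: cvg_inv_sqrt.
have s0 : s n @[n --> \oo] --> 0.
  by rewrite -[X in _ --> X](mulr0 sigma); apply: cvgMr; exact: cvg_inv_sqrt.
have cI := truncated_sqr_cvg Y2 eps0.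
have cJ := truncated_sqr_cvg (@stdnormal_id_L2 R) s0.
have e1 : 0 < p%:R * (e / 2) by rewrite mulr_gt0// divr_gt0.
have e2 : 0 < sigma ^- 2 * (e / 2) by rewrite mulr_gt0 ?invr_gt0 ?exprn_gt0// divr_gt0.
near=> m.
have m0 : (0 < m)%N by near: m; exact: nbhs_infty_gt.
have m0R : 0 < m%:R :> R by rewrite ltr0n.
have sm0 : 0 < Num.sqrt m%:R :> R by rewrite sqrtr_gt0.
have := @lindeberg _ _ _ _ _ hP p _ _ _ Y2 (block_mean hP fr2 fr0 p)
  (block_depends fr_dep (p := p)) sh (eps m) (s m) m.-1 0 (divr_gt0 sigma0 sm0).
rewrite prednK// /s mulrCA divff ?gt_eqF// mulr1.
under eq_Rintegral do rewrite add0r -/(block_sum p m _).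
move=> /le_trans; apply.
rewrite /lindeberg_error mulrCA ler_wpM2l// -addrA mulrDr lerD//.
  rewrite -{1}(ger0_norm (ltW m0R)) -normrM mulrBr.
  rewrite /eps /block_sd; set y := N _; rewrite !expr_div_n exprVn.
  rewrite (@sqr_sqrtr _ m%:R)// (@sqr_sqrtr _ p%:R)// (@sqr_sqrtr _ (m * p)%:R)// natrM.
  rewrite le_eqVlt; apply/orP; left; apply/eqP; congr `|_|.
  by field; rewrite !gt_eqF.
have hI : \int[P]_w (block fr p w ^+ 2 * Num.min `|eps m * block fr p w| 1)
    <= p%:R * (e / 2).
  apply: le_trans (ler_norm _) _; rewrite -normrN -[X in `|X|]sub0r.
  by near: m; move/cvgrPdist_le : cI; apply.
have hJ : \int[@stdnormal R]_z (z ^+ 2 * Num.min `|s m * z| 1) <= sigma ^- 2 * (e / 2).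
  apply: le_trans (ler_norm _) _; rewrite -normrN -[X in `|X|]sub0r.
  by near: m; move/cvgrPdist_le : cJ; apply.
rewrite mulrDr (mulrA _ (eps m ^+ 2)) (mulrA _ ((sigma / _) ^+ 2)).
have -> : m%:R * eps m ^+ 2 = p%:R^-1.
  rewrite /eps exprVn sqr_sqrtr ?ler0n// natrM invfM mulrA divff ?mul1r//.
  by rewrite gt_eqF.
have -> : m%:R * (sigma / Num.sqrt m%:R) ^+ 2 = sigma ^+ 2.
  rewrite expr_div_n sqr_sqrtr ?ler0n// mulrC divfK// gt_eqF//.
rewrite [leRHS](splitr e) lerD//.
- apply: le_trans (ler_wpM2l _ hI) _; first by rewrite invr_ge0.
  by rewrite mulKf// gt_eqF.
- apply: le_trans (ler_wpM2l _ hJ) _; first by rewrite sqr_ge0.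
  by rewrite mulrA mulfV ?mul1r// gt_eqF// exprn_gt0.
Unshelve. all: by end_near. Qed.

Lemma normalized_sum_test_cvg :
  \int[P]_x h (normalized_sum n x) @[n --> \oo] --> gauss_average sigma h 0.
Proof.
apply/cvgrPdist_le => /= e e0.
have K0 := lipschitz_test_ge0 sh.1.
(* h1 and h2, the latter combined with h3, add up to an error of at most B e' *)
pose B := K * (2 * (2 * sigma + 2) + 2) + 1.
have B1 : 1 <= B.
  by rewrite /B lerDr mulr_ge0// addr_ge0// mulr_ge0// addr_ge0// mulr_ge0// ltW.
have B0 : 0 < B by rewrite (lt_le_trans _ B1).
pose e' := Num.min 1 (e / B).
have e'0 : 0 < e' by rewrite lt_min ltr01 divr_gt0.
have e'1 : e' <= 1 by rewrite /e' ge_min lexx.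
have e'B : B * e' <= e.
  by rewrite mulrC -ler_pdivlMr// /e' ge_min lexx orbT.
have [p p0 Hp] := normalized_sum_block_approx e'0.
have sdp := block_sd_close e'0 p0 Hp.
have [M _ HM] := block_sum_test_dist e'0 p0.
near=> n.
have nM : (M <= n %/ p)%N.
  by rewrite leq_divRL//; near: n; exact: nbhs_infty_ge.
have h1 : `|\int[P]_x h (normalized_sum n x) - \int[P]_x h (block_sum p (n %/ p) x)|
    <= K * e'.
  apply: le_trans (lipschitz_test_expectation_dist sh.1
    (normalized_sum_L2 n) (block_sum_L2 p (n %/ p))) _.
  by rewrite ler_wpM2l//; near: n.
have h2 := HM (n %/ p)%N nM; rewrite /= in h2.
have sd0 : 0 <= block_sd p by rewrite divr_ge0 ?nrm_ge0 ?sqrtr_ge0.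
have h3 : `|block_sd p ^+ 2 - sigma ^+ 2| <= 2 * e' * (2 * sigma + 2).
  rewrite subr_sqr normrM ler_pM//.
  rewrite ger0_norm; last by rewrite addr_ge0// asymptotic_sd_ge0.
  by move: sdp; rewrite ler_norml => /andP[? ?]; lra.
rewrite distrC; apply: le_trans e'B.
have h4 := ler_wpM2l K0 h3.
rewrite (_ : _ - _ = (\int[P]_x h (normalized_sum n x) -
   \int[P]_x h (block_sum p (n %/ p) x)) +
   (\int[P]_x h (block_sum p (n %/ p) x) - gauss_average sigma h 0)); last by ring.
apply: le_trans (ler_normD _ _) _.
apply: le_trans (lerD h1 h2) _.
rewrite /B; lra.
Unshelve. all: by end_near. Qed.

End test_function.

End block_approximation.

(** * From smooth test functions to distribution functions *)

Section distribution_function.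
Context {d : measure_display} {T : measurableType d} {R : realType}.
Variable P : probability T R.

Definition cdf_at (X : T -> R) (t : R) : R := fine (P [set x | X x <= t]).

Lemma measurable_cdf_set (X : T -> R) t : measurable_fun setT X ->
  measurable [set x | X x <= t].
Proof.
move=> mX; rewrite -[X in measurable X]setTI.
rewrite (_ : [set x | X x <= t] = X @^-1` `]-oo, t]); last first.
  by apply/seteqP; split => x /=; rewrite in_itv.
exact: mX.
Qed.

Lemma cdf_at_indic (X : T -> R) t : measurable_fun setT X ->
  cdf_at X t = \int[P]_x (\1_[set x | X x <= t] x).
Proof.
move=> mX; rewrite /cdf_at /Rintegral integral_indic ?setIT//.
exact: measurable_cdf_set.
Qed.

Lemma cdf_at_integrable (X : T -> R) t : measurable_fun setT X ->
  P.-integrable setT (EFin \o (\1_[set x | X x <= t] : T -> R)).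
Proof.
move=> mX; apply: (@bounded_integrable _ _ _ P _ 1).
  by apply: measurable_indic; exact: measurable_cdf_set.
by move=> x; rewrite ger0_norm// indicE; case: (_ \in _).
Qed.

Lemma cdf_at_le_test (X : T -> R) (h : R -> R) K t : measurable_fun setT X ->
  lipschitz_test h K -> (forall x, x <= t -> h x = 1) ->
  cdf_at X t <= \int[P]_x h (X x).
Proof.
move=> mX lh h1; rewrite cdf_at_indic//; apply: le_Rintegral => //.
- exact: cdf_at_integrable.
- exact: (lipschitz_test_integrable P lh mX).
- move=> x _; rewrite indicE; case: (boolP (_ \in _)) => [|_].
    by rewrite inE/= => /h1 ->.
  by case: lh => /(_ (X x)) /andP[].
Qed.

Lemma test_le_cdf_at (X : T -> R) (h : R -> R) K t : measurable_fun setT X ->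
  lipschitz_test h K -> (forall x, t <= x -> h x = 0) ->
  \int[P]_x h (X x) <= cdf_at X t.
Proof.
move=> mX lh h0; rewrite cdf_at_indic//; apply: le_Rintegral => //.
- exact: (lipschitz_test_integrable P lh mX).
- exact: cdf_at_integrable.
- move=> x _; rewrite indicE; case: (boolP (_ \in _)) => [_|].
    by case: lh => /(_ (X x)) /andP[].
  by rewrite notin_setE/= => /negP; rewrite -ltNge => /ltW /h0 ->.
Qed.

End distribution_function.

Section gaussian_cdf.
Context {R : realType}.
Variable s : R.
Hypothesis s0 : 0 < s.

Local Notation Q := (normal_prob (0 : R) s : probability _ R).

Lemma gauss_average_normal_prob (h : R -> R) K : lipschitz_test h K ->
  gauss_average s h 0 = \int[Q]_x h x.
Proof.
move=> lh; rewrite /gauss_average /average /Rintegral; apply: (congr1 fine).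
have ch := lipschitz_test_continuous lh.
have h0 z : 0 <= h z by case: lh => /(_ z) /andP[].
rewrite integral_stdnormal_affine// ge0_integral_normal_prob//.
by apply/measurable_EFinP; exact: continuous_measurable_fun.
Qed.

(** The normal density is bounded by its peak. *)
Lemma normal_cdf_increment (t e : R) : 0 <= e ->
  cdf_at Q id (t + e) <= cdf_at Q id t + normal_peak s * e.
Proof.
move=> e0.
have mI (u v : R) : measurable [set x : R | u < x <= v].
  rewrite (_ : [set x : R | u < x <= v] = `]u, v]%classic); first exact: measurable_itv.
  by apply/seteqP; split => x /=; rewrite in_itv.
have mset (u : R) := @measurable_cdf_set _ _ R id u (@measurable_id _ _ _).
rewrite /cdf_at.
have -> : [set x : R | id x <= t + e] = [set x | id x <= t] `|` [set x : R | t < x <= t + e].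
  apply/seteqP; split => x /=.
    by move=> xte; case: (leP x t) => xt; [left|right].
  by case=> [xt|/andP[]//]; rewrite (le_trans xt)// lerDl.
set B := [set x : R | t < x <= t + e].
have QA : (Q B <= (normal_peak s * e)%:E)%E.
  rewrite /= /normal_prob.
  apply: (@le_trans _ _ (\int[lebesgue_measure]_(x in `]t, (t + e)%R]) (normal_peak s)%:E))%E.
    rewrite /B (_ : [set x : R | t < x <= t + e] = `]t, t + e]%classic); last first.
      by apply/seteqP; split => x /=; rewrite in_itv.
    apply: ge0_le_integral => //.
    - by move=> x _; rewrite lee_fin normal_pdf_ge0.
    - by apply/measurable_EFinP/measurable_funTS; exact: measurable_normal_pdf.
    - by move=> x _; rewrite lee_fin normal_pdf_ub// gt_eqF.
  rewrite integral_cst//= lebesgue_measure_itv/= lte_fin.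
  case: ifPn => _; last by rewrite mule0 lee_fin mulr_ge0 ?normal_peak_ge0.
  by rewrite -EFinD -EFinM (addrC t) addrK.
set A := [set x : R | id x <= t].
have mA : measurable A by exact: mset.
have QU : (Q (A `|` B) <= Q A + (normal_peak s * e)%:E)%E.
  by apply: le_trans (measureU2 Q mA (mI _ _)) _; rewrite leeD2l.
have finA : Q A \is a fin_num by exact: fin_num_measure.
have finU : Q (A `|` B) \is a fin_num.
  by apply: fin_num_measure; apply: measurableU => //; exact: mI.
rewrite -[X in _ <= _ + X]/(fine (normal_peak s * e)%:E) -fineD//.
by apply: fine_le => //; rewrite fin_numD finA.
Qed.

End gaussian_cdf.

(** Smooth steps falling from 1 to 0 just after or just before [t] enclose both
    distribution functions at [t]; the error on the Gaussian side is controlled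
    by [normal_cdf_increment]. *)
Lemma cdf_cvg_of_smooth_tests (R : realType) d (T : measurableType d)
    (P : probability T R) (X : nat -> T -> R) (s : R) :
  0 < s -> (forall n, measurable_fun setT (X n)) ->
  (forall h K, smooth_test h K ->
     \int[P]_x h (X n x) @[n --> \oo] --> gauss_average s h 0) ->
  forall t, P [set x | X n x <= t] @[n --> \oo] --> normal_prob 0 s `]-oo, t].
Proof.
move=> s0 mX hX t.
pose Q : probability _ R := normal_prob (0 : R) s.
have mid : measurable_fun [set: R] (@id R) by exact: measurable_id.
have -> : normal_prob 0 s `]-oo, t] = (cdf_at Q id t)%:E.
  rewrite /cdf_at fineK; last by apply: fin_num_measure; exact: measurable_cdf_set.
  congr (normal_prob _ _ _); apply/seteqP; split => x /=; rewrite in_itv//.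
have -> : (fun n => P [set x | X n x <= t]) = (fun n => (cdf_at P (X n) t)%:E).
  apply/funext => n; rewrite /cdf_at fineK//.
  by apply: fin_num_measure; exact: measurable_cdf_set.
apply: cvg_EFin; first by near=> n.
apply/cvgrPdist_le => /= e e0.
have pk0 := normal_peak_ge0 s.
pose delta := e / (2 * (normal_peak s + 1)).
have D0 : 0 < 2 * (normal_peak s + 1) by rewrite mulr_gt0// ltr_wpDl.
have delta0 : 0 < delta by rewrite divr_gt0.
have peak_delta : normal_peak s * delta <= e / 2.
  rewrite /delta mulrA ler_pdivrMr// mulrA divfK// mulrC ler_wpM2l ?(ltW e0)//.
  by rewrite lerDl.
have [hu [Ku [su hu1 hu0]]] := smooth_step t delta0.
have [hl [Kl [sl hl1 hl0]]] := smooth_step (t - delta) delta0.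
rewrite subrK in hl0.
have e2 : 0 < e / 2 by rewrite divr_gt0.
have cu := hX _ _ su; have cl := hX _ _ sl.
rewrite (gauss_average_normal_prob s0 su.1) in cu.
rewrite (gauss_average_normal_prob s0 sl.1) in cl.
have incr1 := normal_cdf_increment s0 t (ltW delta0).
have incr2 := normal_cdf_increment s0 (t - delta) (ltW delta0).
rewrite subrK in incr2.
have qu := test_le_cdf_at Q mid su.1 hu0.
have ql := cdf_at_le_test Q mid sl.1 hl1.
near=> n.
have pu := cdf_at_le_test P (mX n) su.1 hu1.
have pl := test_le_cdf_at P (mX n) sl.1 hl0.
have : `|\int[Q]_x hu x - \int[P]_x hu (X n x)| <= e / 2.
  by near: n; move/cvgrPdist_le : cu; apply.
have : `|\int[Q]_x hl x - \int[P]_x hl (X n x)| <= e / 2.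
  by near: n; move/cvgrPdist_le : cl; apply.
rewrite !ler_norml => /andP[? ?] /andP[? ?].
move: pu pl qu ql incr1 incr2 peak_delta; rewrite -/Q.
set c1 := cdf_at _ _ _; set c2 := cdf_at _ _ _; set c3 := cdf_at _ _ _.
set c4 := cdf_at _ _ _; set w := normal_peak s * delta.
move=> ? ? ? ? ? ? ?; apply/andP; split; lra.
Unshelve. all: by end_near. Qed.

Lemma normal_prob_half_line (R : realType) (s t : R) : 0 < s ->
  (normal_prob 0 s `]-oo, t] =
   ((s * Num.sqrt (2 * pi))^-1)%:E *
    \int[lebesgue_measure]_(u in `]-oo, t]) (expR (- (u ^+ 2 / (2 * s ^+ 2))))%:E)%E.
Proof.
move=> s0; rewrite /normal_prob -ge0_integralZl//; last 2 first.
- apply/measurable_EFinP/measurable_funTS; apply: measurableT_comp => //.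
  apply: measurable_funN; apply: measurable_funM => //; exact: measurable_funX.
- by rewrite lee_fin invr_ge0 mulr_ge0 ?sqrtr_ge0// ltW.
apply: eq_integral => u _; rewrite -EFinM normal_pdfE ?gt_eqF//; congr EFin.
rewrite /normal_peak /normal_fun subr0 mulNr mulr_natl -mulrnAr sqrtrM ?sqr_ge0//.
by rewrite sqrtr_sqr gtr0_norm// !mulr_natl.
Qed.

Section conditional_expectation.
Context {d : measure_display} {E : measurableType d} {R : realType}.
Variables (P : probability (seq_space E) R) (f g : seq_space E -> R) (r : nat).
Hypothesis fg : is_cond_exp P (coord_sigma r) f g.

(** The fibre of [g] through [y] belongs to the sigma-algebra of the first [r]
    coordinates, hence contains every point that agrees with [y] there. *)
Lemma cond_exp_depends : depends_on_first r g.
Proof.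
case: fg => mg _ _ x y xy.
have : coord_sigma r (g @^-1` [set g y]).
  by apply: mg; exists [set g y] => //; rewrite setTI.
move=> /coord_sigma_depends_on_first /(_ x y xy)/= gxy.
by rewrite gxy.
Qed.

Lemma cond_exp_mean : \int[P]_x g x = \int[P]_x f x.
Proof.
case: fg => _ _ fgA; rewrite /Rintegral fgA//.
have [s0 sC _] : sigma_algebra setT (coord_sigma r : set (set (seq_space E))).
  exact: smallest_sigma_algebra.
by have := sC _ s0; rewrite setD0.
Qed.

Lemma cond_exp_measurable : measurable_fun setT g.
Proof. by case: fg => _ /measurable_int/measurable_EFinP. Qed.

End conditional_expectation.

(** * The central limit theorem *)

Local Open Scope ereal_scope.

Theorem theorem2p14 (R : realType) (d : measure_display) (E : measurableType d)
    (mu : probability E R) (P : probability (seq_space E) R)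
    (hP : is_product_measure mu P)
    (f : seq_space E -> R) (hf2 : f \in Lfun P 2%:E) (hf0 : 'E_P[f] = 0)
    (f_ : nat -> seq_space E -> R)
    (hf_ : forall r : nat, (1 <= r)%N -> is_cond_exp P (coord_sigma r) f (f_ r))
    (hphi : \sum_(1 <= r <oo) 'N[P]_2%:E[EFin \o (f \- f_ r)%R] < +oo) :
  exists sigma : R,
    [/\ (0 <= sigma)%R,
        (n%:R^-1)%:E * 'E_P[fun x => (birkhoff_sum f seq_shift n x ^+ 2)%R]
          @[n --> \oo] --> (sigma ^+ 2)%:E &
        (sigma ^+ 2 != 0)%R ->
        forall t : R,
          P [set x | ((Num.sqrt n%:R)^-1 * birkhoff_sum f seq_shift n x <= t)%R]
            @[n --> \oo] -->
          ((sigma * Num.sqrt (2 * pi))^-1)%:E *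
          \int[lebesgue_measure]_(u in `]-oo, t])
            (expR (- (u ^+ 2 / (2 * sigma ^+ 2))))%:E].
Proof.
Local Open Scope ring_scope.
have f0 : \int[P]_x f x = 0 by move: hf0; rewrite unlock /Rintegral => ->.
set phi := fun r => ('N[P]_2%:E[EFin \o (f \- f_ r)%R])%E in hphi.
have phi0 r : (0 <= phi r)%E by exact: Lnorm_ge0.
have partial n : (\sum_(1 <= r < n) phi r <= \sum_(1 <= r <oo) phi r)%E.
  by apply: nneseries_lim_ge => r _ _.
have phi_fin r : (0 < r)%N -> (phi r < +oo)%E.
  move=> r0; apply: le_lt_trans hphi; apply: le_trans (partial r.+1).
  by rewrite big_nat_recr//= leeDr// sume_ge0.
have d2 r : (0 < r)%N -> (fun x => f x - f_ r x) \in Lfun P 2%:E.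
  move=> r0; rewrite inE; apply/andP; split; rewrite inE/=; last exact: phi_fin.
  apply: measurable_funB; first exact: L2_measurable hf2.
  exact: cond_exp_measurable (hf_ r r0).
have fr2 r : (0 < r)%N -> f_ r \in Lfun P 2%:E.
  move=> r0; rewrite (_ : f_ r = fun x => f x - (f x - f_ r x)).
    exact: L2B hf2 (d2 r r0).
  by apply/funext => x; rewrite subKr.
have fr0 r : (0 < r)%N -> \int[P]_x f_ r x = 0.
  by move=> r0; rewrite (cond_exp_mean (hf_ r r0)).
have fr_dep r : (0 < r)%N -> depends_on_first r (f_ r).
  by move=> r0; exact: cond_exp_depends (hf_ r r0).
set S := (\sum_(1 <= r <oo) phi r)%E in hphi partial.
have hC n : \sum_(k < n) nrm P (fun x => f x - f_ k.+1 x) <= fine S.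
  have S0 : (0 <= S)%E by apply: nneseries_ge0.
  rewrite -lee_fin fineK ?ge0_fin_numE//; apply: le_trans (partial n.+1).
  rewrite big_add1/= big_mkord -sumEFin.
  apply: lee_sum => k _.
  by rewrite -(Lnorm2E (d2 k.+1 isT)).
pose sigma := asymptotic_sd P f.
have cvg_sigma := asymptotic_sd_cvg hP hf2 f0 fr2 fr0 fr_dep hC.
have sigma_ge0 := asymptotic_sd_ge0 hP hf2 f0 fr2 fr0 fr_dep hC.
exists sigma; split => //.
- have -> : (fun n => (n%:R^-1)%:E *
      'E_P[fun x => (birkhoff_sum f seq_shift n x ^+ 2)%R])%E =
      (fun n => (nrm P (normalized_sum f n) ^+ 2)%:E).
    apply/funext => n; have S2 := L2_birkhoff_sum hP 1 n hf2.
    rewrite nrmZ// exprMn real_normK ?num_real// exprVn sqr_sqrtr ?ler0n//.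
    rewrite EFinM nrm_sqrE /Rintegral fineK ?unlock//.
    by apply: integrable_fin_num => //; exact: L2_sqr_integrable.
  by apply: cvg_EFin; [near=> n|apply: cvgM].
- move=> sigma2 t.
  have sigma_gt0 : 0 < sigma.
    by move: sigma2; rewrite expf_eq0/= lt_neqAle sigma_ge0 andbT eq_sym.
  rewrite -normal_prob_half_line//.
  apply: (cdf_cvg_of_smooth_tests (X := normalized_sum f) sigma_gt0).
    move=> n; exact: L2_measurable (normalized_sum_L2 hP hf2 n).
  move=> h K sh.
  exact: (normalized_sum_test_cvg hP hf2 f0 fr2 fr0 fr_dep hC sh sigma_gt0).
Unshelve. all: by end_near. Qed.
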